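(* Let $R$ be a commutative Noetherian local ring, $\mathfrak{a}$ an ideal of $R$, and $X\in\mathcal{D}_+(R)$ with $\mathrm{depth}(\mathfrak{a},X)<\infty$. Then $$\mathrm{depth}(\mathfrak{a},X)\le\mathrm{cd}(\mathfrak{a},X).$$
   Context: Complexes are graded homologically (differentials $X_\ell\to X_{\ell-1}$). $\mathcal{D}(R)$ is the derived category of $R$-modules; $\mathcal{D}_+(R)$ is the full subcategory of complexes $X$ with $H_\ell(X)=0$ for $\ell\ll 0$. $\sup X=\sup\{\ell\mid H_\ell(X)\ne0\}$, which is $-\infty$ if $H(X)=0$. $\mathrm{depth}(\mathfrak{a},X)=-\sup\mathbf{R}\mathrm{Hom}_R(R/\mathfrak{a},X)=\inf\{\ell\in\mathbb{Z}\mid H_{-\ell}(\mathbf{R}\mathrm{Hom}_R(R/\mathfrak{a},X))\neq0\}$. For an $R$-module $M$, $\mathrm{cd}(\mathfrak{a},M)=\sup\{i\in\mathbb{Z}\mid H^i_{\mathfrak{a}}(M)\neq0\}$, where $H^i_{\mathfrak a}$ denotes local cohomology. For a complex $X$, $\mathrm{cd}(\mathfrak{a},X)=\sup\{\mathrm{cd}(\mathfrak{a},H_\ell(X))-\ell\mid \ell\in\mathbb{Z}\}$. All sups and infs are taken in $\mathbb{Z}\cup\{\pm\infty\}$, with $\sup\emptyset=-\infty$. *)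

(* Defs.v *)
From HB Require Import structures.
From mathcomp Require Import all_boot all_order all_algebra generic_quotient ring_quotient.
From mathcomp Require Import boolp classical_sets functions constructive_ereal.
From mathcomp Require Import multinomials.freeg.
Set Implicit Arguments. Unset Strict Implicit. Unset Printing Implicit Defensive.
Import Order.TTheory GRing.Theory Num.Theory.
Local Open Scope classical_set_scope.
Local Open Scope ring_scope.

Section Submodules.
Context {R : comNzRingType} (V : lmodType R).

Record submod_axioms (P : V -> Prop) : Prop := SubmodAxioms {
  submod_ax0 : P 0;
  submod_axD : forall x y, P x -> P y -> P (x + y);
  submod_axZ : forall c x, P x -> P (c *: x)
}.

Lemma submod_axioms_closed P :
  submod_axioms P -> GRing.subsemimod_closed (fun x : V => `[< P x >]).
Proof.
case=> P0 PD PZ; split; first split.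
- exact: asboolT.
- by move=> x y /asboolP Px /asboolP Py; apply/asboolP/PD.
- by move=> c x /asboolP Px; apply/asboolP/PZ.
Qed.

Definition submod_of P (PS : submod_axioms P) : submodClosed V :=
  HB.pack (fun x : V => `[< P x >])
    (GRing.isSubSemiModClosed.Build R V (fun x => `[< P x >])
       (submod_axioms_closed PS)).

Lemma in_submod_of P (PS : submod_axioms P) x : x \in submod_of PS <-> P x.
Proof. by split=> [/asboolP|Px]; last exact/asboolP. Qed.

Variable S : submodClosed V.

Definition submod : Type := {x : V | x \in S}.
HB.instance Definition _ := [isSub of submod for @proj1_sig V (fun x => x \in S)].
HB.instance Definition _ := [Choice of submod by <:].
HB.instance Definition _ := [SubChoice_isSubLmodule of submod by <:].

Lemma submod_val0 : val (0 : submod) = 0.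
Proof. exact: linear0. Qed.

Lemma submod_zmod_closed : zmod_closed (fun x : V => x \in S).
Proof. by apply: GRing.subsemimod_closedB; split; [exact: (rpred0D S) | move=> c x; exact: rpredZ]. Qed.

Definition submod_zmod : zmodClosed V :=
  HB.pack (fun x : V => x \in S)
    (GRing.isZmodClosed.Build V (fun x => x \in S) submod_zmod_closed).

Definition quotmod : Type := Quotient.quot submod_zmod.
HB.instance Definition _ := GRing.Zmodule.on quotmod.

Definition qpi (x : V) : quotmod := (\pi_(Quotient.quot submod_zmod) x)%qT.

Lemma qpi_eq x y : qpi x = qpi y <-> x - y \in S.
Proof.
split=> [/eqP|Sxy]; first by rewrite -Quotient.idealrBE.
by apply/eqP; rewrite -Quotient.idealrBE.
Qed.

Lemma qpiB : zmod_morphism qpi.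
Proof. by move=> x y; rewrite /qpi !piE. Qed.

Lemma qpi_surj (y : quotmod) : exists x, qpi x = y.
Proof. by exists (repr y); exact: reprK. Qed.

Let scale (c : R) (y : quotmod) : quotmod := qpi (c *: repr y).

Let scaleE c x : scale c (qpi x) = qpi (c *: x).
Proof.
apply/qpi_eq; rewrite -scalerBr; apply: rpredZ; apply/qpi_eq.
exact: reprK.
Qed.

Let qD x y : qpi (x + y) = qpi x + qpi y.
Proof. by rewrite /qpi !piE. Qed.

Let scaleA a b v : scale a (scale b v) = scale (a * b) v.
Proof. by have [x <-] := qpi_surj v; rewrite !scaleE scalerA. Qed.
Let scale1 : left_id 1 scale.
Proof. by move=> v; have [x <-] := qpi_surj v; rewrite !scaleE scale1r. Qed.
Let scaleDr : right_distributive scale +%R.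
Proof.
move=> c u v; have [x <-] := qpi_surj u; have [y <-] := qpi_surj v.
by rewrite -qD !scaleE scalerDr qD.
Qed.
Let scaleDl v : {morph scale^~ v : a b / a + b}.
Proof.
by move=> a b; have [x <-] := qpi_surj v; rewrite !scaleE scalerDl qD.
Qed.

HB.instance Definition _ :=
  GRing.Zmodule_isLmodule.Build R quotmod scaleA scale1 scaleDr scaleDl.
HB.instance Definition _ := GRing.isZmodMorphism.Build V quotmod qpi qpiB.
Lemma qpiZ : scalable qpi.
Proof. by move=> c x; rewrite -scaleE. Qed.
HB.instance Definition _ := GRing.isScalable.Build R V quotmod *:%R qpi qpiZ.

End Submodules.
Arguments qpi {R V} S.

Section Kernel.
Context {R : comNzRingType}.
Variables (U V : lmodType R) (f : {linear U -> V}).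

Lemma ker_submod : submod_axioms (fun x => f x = 0).
Proof.
split; first exact: linear0.
- by move=> x y fx fy; rewrite linearD fx fy addr0.
- by move=> c x fx; rewrite linearZ_LR fx scaler0.
Qed.

Lemma im_submod : submod_axioms (fun y => exists x, f x = y).
Proof.
split; first by exists 0; exact: linear0.
- by move=> _ _ [x <-] [y <-]; exists (x + y); rewrite linearD.
- by move=> c _ [x <-]; exists (c *: x); rewrite linearZ_LR.
Qed.

Definition ker : submodClosed U := submod_of ker_submod.
Definition im : submodClosed V := submod_of im_submod.

Lemma in_ker x : x \in ker <-> f x = 0.
Proof. exact: in_submod_of. Qed.

Lemma in_im y : y \in im <-> exists x, f x = y.
Proof. exact: in_submod_of. Qed.
End Kernel.


Section Subquotient.
Context {R : comNzRingType} {V : lmodType R}.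

Lemma zero_submod : submod_axioms (fun x : V => x = 0).
Proof.
by split=> // [x y -> ->|c x ->]; rewrite ?addr0 ?scaler0.
Qed.

Definition zeromod : submodClosed V := submod_of zero_submod.

Lemma preim_submod (Z B : submodClosed V) :
  submod_axioms (fun z : submod Z => val z \in B).
Proof.
split; first by rewrite linear0 rpred0.
- by move=> x y xB yB; rewrite linearD rpredD.
- by move=> c x xB; rewrite linearZ_LR rpredZ.
Qed.

(* Z / (Z :&: B) *)
Definition subquot (Z B : submodClosed V) : lmodType R :=
  quotmod (submod_of (preim_submod Z B)).
End Subquotient.

Definition trivial_module (R : comNzRingType) (M : lmodType R) : Prop :=
  forall x : M, x = 0.

(* Homological grading. The differential is a family d i j : X_i -> X_j that
   vanishes unless i = j + 1, so that no transport between X_(i + 1 - 1) and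
   X_i is needed. *)
Record complex (R : comNzRingType) := Complex {
  cobj :> int -> lmodType R;
  cdiff : forall i j, {linear cobj i -> cobj j};
  cdiff_shape : forall i j, i <> j + 1 -> forall x, cdiff i j x = 0;
  cdiff_comp : forall i j k x, cdiff j k (cdiff i j x) = 0
}.

Definition homology (R : comNzRingType) (X : complex R) (l : int) : lmodType R :=
  subquot (ker (cdiff X l (l - 1))) (im (cdiff X (l + 1) l)).

Definition D_plus (R : comNzRingType) (X : complex R) : Prop :=
  exists n : int, forall l, l < n -> trivial_module (homology X l).

Definition injective_module (R : comNzRingType) (E : lmodType R) : Prop :=
  forall (A B : lmodType R) (i : {linear A -> B}) (f : {linear A -> E}),
    injective i -> exists g : {linear B -> E}, forall x, g (i x) = f x.

Definition projective_module (R : comNzRingType) (P : lmodType R) : Prop :=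
  forall (A B : lmodType R) (p : {linear A -> B}) (f : {linear P -> B}),
    (forall y, exists x, p x = y) ->
    exists g : {linear P -> A}, forall x, p (g x) = f x.

Record projective_resolution (R : comNzRingType) (M : lmodType R) := {
  pr_obj :> nat -> lmodType R;
  pr_diff : forall n, {linear pr_obj n.+1 -> pr_obj n};
  pr_aug : {linear pr_obj 0 -> M};
  pr_proj : forall n, projective_module (pr_obj n);
  pr_aug_surj : forall y, exists x, pr_aug x = y;
  pr_exact0 : forall x, pr_aug x = 0 <-> exists y, pr_diff 0 y = x;
  pr_exact : forall n x, pr_diff n x = 0 <-> exists y, pr_diff n.+1 y = x
}.

Record injective_resolution (R : comNzRingType) (M : lmodType R) := {
  ir_obj :> nat -> lmodType R;
  ir_diff : forall n, {linear ir_obj n -> ir_obj n.+1};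
  ir_aug : {linear M -> ir_obj 0};
  ir_inj : forall n, injective_module (ir_obj n);
  ir_aug_inj : injective ir_aug;
  ir_exact0 : forall x, ir_diff 0 x = 0 <-> exists y, ir_aug y = x;
  ir_exact : forall n x, ir_diff n.+1 x = 0 <-> exists y, ir_diff n y = x
}.

Section HomComplex.
Context {R : comNzRingType}.
Variables (P : nat -> lmodType R) (d : forall n, {linear P n.+1 -> P n}).
Context (dd : forall n x, d n (d n.+1 x) = 0).
Variable X : complex R.

(* Hom(P, X)_n = \prod_p Hom(P_p, X_(p + n)), as families of linear maps
   P_p -> X_q that vanish unless q = p + n. *)
Record hom_obj (n : int) := HomObj {
  hom_fun :> forall (p : nat) (q : int), P p -> X q;
  hom_lin : forall p q, linear (@hom_fun p q);
  hom_shape : forall p q, q <> p%:Z + n -> forall x, @hom_fun p q x = 0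
}.
Arguments hom_fun {n} h p q x.

HB.instance Definition _ n := gen_eqMixin (hom_obj n).
HB.instance Definition _ n := gen_choiceMixin (hom_obj n).

Lemma hom_objP n (f g : hom_obj n) : (forall p q x, f p q x = g p q x) -> f = g.
Proof.
case: f g => [f fl fs] [g gl gs] /= fg.
have {}fg : f = g by apply: functional_extensionality_dep => p;
  apply: functional_extensionality_dep => q; apply: funext => x.
by rewrite -{}fg in gl gs *; congr HomObj; exact: Prop_irrelevance.
Qed.

Lemma hom_fun0 n (f : hom_obj n) p q : f p q 0 = 0.
Proof.
by have := @hom_lin n f p q (-1) 0 0; rewrite scaler0 addr0 scaleN1r addNr.
Qed.

Section Operations.
Variable n : int.
Implicit Types f g : hom_obj n.

Fact hom0_lin p q : linear (fun _ : P p => 0 : X q).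
Proof. by move=> c x y; rewrite scaler0 addr0. Qed.
Definition hom0 : hom_obj n :=
  HomObj hom0_lin (fun p q _ _ => erefl (0 : X q)).

Fact homD_lin f g p q : linear (fun x => f p q x + g p q x).
Proof. by move=> c x y; rewrite !hom_lin scalerDr addrACA. Qed.
Fact homD_shape f g p q :
  q <> p%:Z + n -> forall x, f p q x + g p q x = 0.
Proof. by move=> h x; rewrite !hom_shape ?addr0. Qed.
Definition homD f g : hom_obj n := HomObj (homD_lin f g) (@homD_shape f g).

Fact homZ_lin a f p q : linear (fun x => a *: f p q x).
Proof. by move=> c x y; rewrite hom_lin scalerDr !scalerA mulrC. Qed.
Fact homZ_shape a f p q : q <> p%:Z + n -> forall x, a *: f p q x = 0.
Proof. by move=> h x; rewrite hom_shape ?scaler0. Qed.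
Definition homZ a f : hom_obj n := HomObj (homZ_lin a f) (@homZ_shape a f).

Fact homDA : associative homD.
Proof. by move=> f g h; apply: hom_objP => p q x /=; rewrite addrA. Qed.
Fact homDC : commutative homD.
Proof. by move=> f g; apply: hom_objP => p q x /=; rewrite addrC. Qed.
Fact hom0D : left_id hom0 homD.
Proof. by move=> f; apply: hom_objP => p q x /=; rewrite add0r. Qed.
Fact homND : left_inverse hom0 (homZ (-1)) homD.
Proof. by move=> f; apply: hom_objP => p q x /=; rewrite scaleN1r addNr. Qed.
HB.instance Definition _ :=
  GRing.isZmodule.Build (hom_obj n) homDA homDC hom0D homND.

Fact homZA a b f : homZ a (homZ b f) = homZ (a * b) f.
Proof. by apply: hom_objP => p q x /=; rewrite scalerA. Qed.
Fact homZ1 : left_id 1 homZ.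
Proof. by move=> f; apply: hom_objP => p q x /=; rewrite scale1r. Qed.
Fact homZDr : right_distributive homZ +%R.
Proof. by move=> c f g; apply: hom_objP => p q x /=; rewrite scalerDr. Qed.
Fact homZDl f : {morph homZ^~ f : a b / a + b}.
Proof. by move=> a b; apply: hom_objP => p q x /=; rewrite scalerDl. Qed.
HB.instance Definition _ :=
  GRing.Zmodule_isLmodule.Build R (hom_obj n) homZA homZ1 homZDr homZDl.
End Operations.

(* f_(p - 1) \o d^P_p, with the convention P_(-1) = 0 *)
Definition hom_precomp n (f : hom_obj n) (p : nat) (q : int) : P p -> X q :=
  match p with
  | 0 => fun=> 0
  | p'.+1 => fun x => f p' q (d p' x)
  end.

(* (df)_p = d^X \o f_p - (-1)^n f_(p - 1) \o d^P_p *)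
Definition hom_dfun n m (f : hom_obj n) (p : nat) (q : int) (x : P p) : X q :=
  if n == m + 1 then
    cdiff X (q + 1) q (f p (q + 1) x) - (-1) ^+ `|n|%N *: hom_precomp f q x
  else 0.

Fact hom_precomp_lin n (f : hom_obj n) p q : linear (@hom_precomp n f p q).
Proof.
case: p => [|p] c x y /=; first by rewrite scaler0 addr0.
by rewrite linearP hom_lin.
Qed.

Fact hom_dfun_lin n m (f : hom_obj n) p q : linear (@hom_dfun n m f p q).
Proof.
move=> c x y; rewrite /hom_dfun; case: eqP => _; last by rewrite scaler0 addr0.
rewrite hom_lin linearP hom_precomp_lin scalerDr scalerBr !scalerA.
by rewrite [_ * c]mulrC opprD addrACA.
Qed.

Fact hom_dfun_shape n m (f : hom_obj n) p q :
  q <> p%:Z + m -> forall x, @hom_dfun n m f p q x = 0.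
Proof.
move=> h x; rewrite /hom_dfun; case: eqP => // nm.
rewrite hom_shape ?linear0 ?sub0r; last first.
  by rewrite nm addrA => /addIr.
case: p x h => [|p] x h /=; first by rewrite scaler0 oppr0.
rewrite hom_shape ?scaler0 ?oppr0 // nm => E; apply: h.
by rewrite E intS addrA addrAC [1 + _]addrC.
Qed.

Definition hom_diff n m (f : hom_obj n) : hom_obj m :=
  HomObj (@hom_dfun_lin n m f) (@hom_dfun_shape n m f).

Fact hom_diff_lin n m : linear (@hom_diff n m).
Proof.
move=> c f g; apply: hom_objP => p q x /=; rewrite /hom_dfun.
case: eqP => _; last by rewrite scaler0 addr0.
have -> : hom_precomp (c *: f + g) q x =
    c *: hom_precomp f q x + hom_precomp g q x.
  by case: p x => [|p] x //=; rewrite scaler0 addr0.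
rewrite /= linearP scalerDr scalerBr !scalerA.
by rewrite [_ * c]mulrC opprD addrACA.
Qed.

HB.instance Definition _ n m := GRing.isLinear.Build R (hom_obj n) (hom_obj m) *:%R
  (@hom_diff n m) (@hom_diff_lin n m).

Fact hom_complex_shape n m :
  n <> m + 1 -> forall f : hom_obj n, (@hom_diff n m f : hom_obj m) = 0.
Proof.
by move=> /eqP/negPf nm f; apply: hom_objP => p q x /=; rewrite /hom_dfun nm.
Qed.

Fact hom_complex_comp n m k (f : hom_obj n) :
  (@hom_diff m k (@hom_diff n m f) : hom_obj k) = 0.
Proof.
apply: hom_objP => p q x /=; rewrite /hom_dfun.
case: eqP => // mk /=; rewrite /hom_dfun.
case: eqP => nm; last first.
  rewrite linear0 sub0r; move/eqP/negPf: nm => nm.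
  by case: p x => [|p] x /=; rewrite /hom_dfun ?nm scaler0 oppr0.
rewrite linearB /= cdiff_comp sub0r linearZ_LR /=.
have -> : (-1) ^+ `|n|%N = - (-1) ^+ `|m|%N :> R.
  rewrite nm; case: (m) => [a|[|a]].
  - by rewrite -PoszD addn1 !absz_nat exprS mulN1r.
  - by rewrite /= expr1 opprK.
  - have -> : Negz a.+1 + 1 = Negz a.
      by rewrite !NegzE (intS a.+1) opprD addrAC addNr add0r.
    by rewrite /= [in RHS]exprS mulN1r opprK.
case: p x => [|p] x /=; first by rewrite !(linear0, scaler0, oppr0, subr0).
rewrite /hom_dfun (introT eqP nm) /=.
have -> : hom_precomp f q (d p x) = 0.
  by case: p x => [|p] x //=; rewrite dd hom_fun0.
by rewrite scaler0 subr0 scaleNr opprK subrr.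
Qed.

Definition hom_complex : complex R :=
  @Complex R (fun n => hom_obj n : lmodType R) (fun n m => @hom_diff n m)
    hom_complex_shape hom_complex_comp.
End HomComplex.


Section FreeResolution.
Context {R : comNzRingType}.

Section Free.
Variable K : choiceType.

Definition freemod : lmodType R := {freeg K / R}.

Variables (N : lmodType R) (a : K -> N).

Definition free_lift (D : freemod) : N := fglift a D.

Fact free_liftB : zmod_morphism free_lift.
Proof. exact: lift_is_additive. Qed.
HB.instance Definition _ :=
  GRing.isZmodMorphism.Build freemod N free_lift free_liftB.

Lemma free_liftU k x : free_lift << k *g x >> = k *: a x.
Proof. exact: liftU. Qed.

Fact free_liftZ : scalable free_lift.
Proof.
move=> c D.
have -> : c *: D = \sum_(x <- dom D) << c * coeff x D *g x >> by [].
rewrite -[in RHS](freeg_sumE D) !raddf_sum; apply: eq_bigr => x _.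
by rewrite /= !free_liftU scalerA.
Qed.
HB.instance Definition _ :=
  GRing.isScalable.Build R freemod N *:%R free_lift free_liftZ.

Lemma free_lift_unique (f : {linear freemod -> N}) :
  (forall x, f << x >> = a x) -> f =1 free_lift.
Proof.
move=> fa D; rewrite -[D]freeg_sumE !raddf_sum; apply: eq_bigr => x _.
rewrite /= free_liftU -fa -linearZ_LR; congr (f _).
by apply/eqP/freeg_eqP => y; rewrite coeffZ !coeffU mul1r.
Qed.
End Free.

Lemma free_projective (K : choiceType) : projective_module (freemod K).
Proof.
move=> A B p f psurj.
have [a aP] : {a : K -> A | forall x, p (a x) = f << x >>}.
  by exists (fun x => projT1 (cid (psurj (f << x >>)))) => x; case: cid.
exists (free_lift a) => D /=.
rewrite (@free_lift_unique _ _ (fun x => f << x >>) f) //.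
have -> : p (free_lift a D) = (p \o free_lift a : {linear _ -> _}) D by [].
by apply: free_lift_unique => x /=; rewrite free_liftU scale1r.
Qed.

Variable M : lmodType R.

Definition cover (N : lmodType R) : {linear freemod N -> N} :=
  @free_lift N N id.

Lemma cover_surj (N : lmodType R) (y : N) : exists x, cover N x = y.
Proof. by exists << y >>; rewrite /cover /= free_liftU scale1r. Qed.

Fixpoint syzygy (n : nat) : lmodType R :=
  if n is n'.+1 then submod (ker (cover (syzygy n'))) else M.

Definition free_diff n : {linear freemod (syzygy n.+1) -> freemod (syzygy n)} :=
  val \o cover (syzygy n.+1).

Fact free_diff_exact n x :
  cover (syzygy n) x = 0 <-> exists y, free_diff n y = x.
Proof.
split=> [|[y <-]]; last by apply/in_ker/valP.
move=> /in_ker xK; have [y yx] := @cover_surj (syzygy n.+1) (Sub x xK).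
by exists y; rewrite /free_diff /= yx.
Qed.

Fact free_exact n x : free_diff n x = 0 <-> exists y, free_diff n.+1 y = x.
Proof.
rewrite -free_diff_exact /free_diff /=; split=> [|->]; last by [].
by move=> h; apply: val_inj; rewrite submod_val0.
Qed.

Definition free_resolution : projective_resolution M :=
  {| pr_obj n := freemod (syzygy n);
     pr_diff := free_diff;
     pr_aug := cover M;
     pr_proj n := @free_projective (syzygy n);
     pr_aug_surj := @cover_surj M;
     pr_exact0 := @free_diff_exact 0;
     pr_exact := free_exact |}.

End FreeResolution.

Lemma pr_diff_comp (R : comNzRingType) (M : lmodType R)
  (P : projective_resolution M) n x : pr_diff P n (pr_diff P n.+1 x) = 0.
Proof. by apply/pr_exact; exists x. Qed.

(* RHom_R(M, X), computed by a projective resolution of M; as such a resolution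
   is bounded below, no boundedness condition on X is needed. *)
Definition RHom (R : comNzRingType) (M : lmodType R) (X : complex R) : complex R :=
  hom_complex (@pr_diff_comp R M (free_resolution M)) X.

(* Enough injectives: M embeds in Hom_Z(R, D^T), where D = Q/Z and T is the set
   of additive maps M -> D. *)
Fact rat_int_closed : zmod_closed (fun x : rat => x \is a Num.int).
Proof. split=> [|x y xint yint]; first exact: (int_num0 rat).
by change (x - y \is a Num.int); exact: rpredB. Qed.
Definition rat_int : zmodClosed rat := HB.pack (fun x : rat => x \is a Num.int)
  (GRing.isZmodClosed.Build rat (fun x : rat => x \is a Num.int) rat_int_closed).
Definition QmodZ : zmodType := Quotient.quot rat_int.

Section Divisible.

Definition qz (x : rat) : QmodZ := (\pi_(Quotient.quot rat_int) x)%qT.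

Lemma qzB : zmod_morphism qz.
Proof. by move=> x y; rewrite /qz !piE. Qed.
HB.instance Definition _ := GRing.isZmodMorphism.Build rat QmodZ qz qzB.

Lemma qz_eq0 x : qz x = 0 <-> x \is a Num.int.
Proof.
rewrite -(raddf0 qz); split=> [/eqP|xint].
  by rewrite -Quotient.idealrBE subr0.
by apply/eqP; rewrite -Quotient.idealrBE subr0.
Qed.

Lemma QmodZ_divisible (d : QmodZ) (n : int) : n != 0 -> exists e, e *~ n = d.
Proof.
move=> n0; exists (qz (repr d / n%:~R)); rewrite -raddfMz -mulrzl mulrC divfK.
  exact: reprK.
by rewrite intr_eq0.
Qed.

Variable B : zmodType.
Implicit Types G : set (B * QmodZ).

Record pmap G : Prop := PMap {
  pmap0 : G (0, 0);
  pmapB : forall x y x' y', G (x, y) -> G (x', y') -> G (x - x', y - y');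
  pmap_fun : forall y, G (0, y) -> y = 0
}.

Lemma pmapMz G x y k : pmap G -> G (x, y) -> G (x *~ k, y *~ k).
Proof.
case=> G0 GB _ Gxy.
have GN z t : G (z, t) -> G (- z, - t).
  by move=> /(GB _ _ _ _ G0); rewrite !sub0r.
have GM (n : nat) : G (x *+ n, y *+ n).
  elim: n => [|n IH]; rewrite ?mulr0n ?mulrS //.
  by have := GB _ _ _ _ Gxy (GN _ _ IH); rewrite !opprK.
case: k => n; first exact: GM.
by rewrite NegzE !mulrNz; apply: GN; exact: GM.
Qed.

Lemma pmap_extend1 G (b : B) : pmap G ->
  exists G', [/\ pmap G', G `<=` G' & exists d, G' (b, d)].
Proof.
move=> PG; have [G0 GB Gf] := PG.
have GD x y x' y' : G (x, y) -> G (x', y') -> G (x + x', y + y').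
  move=> h h'; have := GB _ _ _ _ h (GB _ _ _ _ G0 h').
  by rewrite !sub0r !opprK.
have [d dP] : exists d, forall (k : int) w, G (b *~ k, w) -> w = d *~ k.
  pose Q (n : nat) := `[< exists w, G (b *+ n.+1, w) >].
  have [exQ|nQ] := pselect (exists n, Q n); last first.
    have nG (n : nat) w : ~ G (b *+ n.+1, w).
      by move=> h; apply: nQ; exists n; apply/asboolP; exists w.
    exists 0 => -[[|n]|n] w; rewrite mul0rz.
    - by rewrite mulr0z; exact: Gf.
    - by move=> /nG.
    - move=> h; have := GB _ _ _ _ G0 h.
      by rewrite NegzE mulrNz !sub0r opprK => /nG.
  have [n /asboolP[v Gv] nmin] := ex_minnP exQ.
  have [//|d dv] := @QmodZ_divisible v n.+1%:Z.
  exists d => k w Gkw.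
  have h := pmapMz (k %/ n.+1%:Z)%Z PG Gv.
  have := GB _ _ _ _ Gkw h.
  have Ek : k = (k %/ n.+1%:Z)%Z * n.+1%:Z + (k %% n.+1%:Z)%Z by exact: divz_eq.
  rewrite -[b *+ n.+1]/(b *~ n.+1%:Z) -mulrzA -mulrzBr.
  rewrite [k in k - _]Ek [n.+1%:Z * _]mulrC addrAC subrr add0r.
  have : (k %% n.+1%:Z)%Z < n.+1%:Z by rewrite ltz_pmod.
  have : 0 <= (k %% n.+1%:Z)%Z by rewrite modz_ge0.
  case Er : (k %% n.+1%:Z)%Z => [[|r]|r] // _ rn.
    rewrite mulr0z => /Gf /eqP; rewrite subr_eq0 => /eqP ->.
    by rewrite -dv -mulrzA [in RHS]Ek Er addr0 mulrC.
  move=> Gr; have /nmin : Q r by apply/asboolP; eexists; exact: Gr.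
  by move: rn; rewrite ltz_nat ltnS => /leq_trans h1 /h1; rewrite ltnn.
exists [set p | exists x y k, G (x, y) /\ p = (x + b *~ k, y + d *~ k)].
split.
- split.
  + by exists 0, 0, 0; rewrite !mulr0z !addr0.
  + move=> x y x' y' [u [v [k [Guv [-> ->]]]]] [u' [v' [k' [Guv' [-> ->]]]]].
    exists (u - u'), (v - v'), (k - k'); split; first exact: GB.
    by rewrite !mulrzBr !opprD; congr pair; rewrite addrACA.
  + move=> y [u [v [k [Guv [/esym/eqP Eu ->]]]]].
    move: Eu; rewrite addr_eq0 => /eqP Eu; move: Guv; rewrite Eu -mulrNz.
    by move=> /dP ->; rewrite mulrNz addNr.
- by move=> [x y] Gxy; exists x, y, 0; rewrite !mulr0z !addr0.
- by exists d, 0, 0, 1; rewrite !mulr1z !add0r.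
Qed.

Lemma pmap_extend G : pmap G ->
  exists g : B -> QmodZ, zmod_morphism g /\ forall x y, G (x, y) -> g x = y.
Proof.
move=> PG.
pose good := [set X : set (B * QmodZ) | X = set0 \/ (G `<=` X /\ pmap X)].
have [A [goodA maxA]] : exists A, good A /\ forall A', A `<` A' -> ~ good A'.
  apply: Zorn_bigcup => F Fgood Ftot.
  have [[X [FX X0]]|nF] := pselect (exists X, F X /\ X <> set0); last first.
    left; rewrite -subset0 => p [X FX Xp]; apply: nF; exists X; split=> // X0.
    by rewrite X0 in Xp.
  have [//|[GX PX]] := Fgood _ FX; right; split.
    by move=> p /GX Xp; exists X.
  split.
  - by exists X => //; exact: pmap0 PX.
  - move=> x y x' y' [Y FY Yp] [Z FZ Zp].
    have [YZ|ZY] := Ftot _ _ FY FZ.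
      have [Z0|[_ PZ]] := Fgood _ FZ; first by rewrite Z0 in Zp.
      by exists Z => //; apply: pmapB Zp => //; exact: YZ.
    have [Y0|[_ PY]] := Fgood _ FY; first by rewrite Y0 in Yp.
    by exists Y => //; apply: pmapB Yp _ => //; exact: ZY.
  - move=> y [Y FY Yp]; have [Y0|[_ PY]] := Fgood _ FY; first by rewrite Y0 in Yp.
    exact: pmap_fun Yp.
have [GA PA] : G `<=` A /\ pmap A.
  case: goodA => // A0; exfalso; apply: (maxA G); last by right; split.
  by rewrite A0; split; [exact: sub0set | move=> /(_ _ (pmap0 PG))].
have Atot b : exists d, A (b, d).
  have [A' [PA' AA' [d A'd]]] := pmap_extend1 b PA.
  have [|nA] := pselect (exists d, A (b, d)) => //; exfalso.
  apply: (maxA A'); last by right; split=> //; exact: subset_trans AA'.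
  by split=> // A'A; apply: nA; exists d; exact: A'A.
have [g gP] : {g : B -> QmodZ | forall b, A (b, g b)}.
  by exists (fun b => projT1 (cid (Atot b))) => b; case: cid.
have gE x y : A (x, y) -> g x = y.
  move=> Axy; apply/eqP; rewrite -subr_eq0; apply/eqP; apply: (pmap_fun PA).
  by have := pmapB PA (gP x) Axy; rewrite subrr.
exists g; split=> [x y|x y /GA]; last exact: gE.
by apply: gE; exact: pmapB.
Qed.

Lemma QmodZ_cogenerator (m : B) : m <> 0 ->
  exists g : B -> QmodZ, zmod_morphism g /\ g m <> 0.
Proof.
move=> m0.
have [d d0 dP] : exists2 d : QmodZ, d <> 0 & forall k : int, m *~ k = 0 -> d *~ k = 0.
  pose Q (n : nat) := m *+ n.+1 == 0.
  have [exQ|nQ] := pselect (exists n, Q n); last first.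
    have nQ' n : m *+ n.+1 <> 0 by move=> h; apply: nQ; exists n; exact/eqP.
    exists (qz (1 / 2)); first by move=> /qz_eq0.
    move=> [[|n]|n]; rewrite ?mulr0z //; first by move=> /nQ'.
    by rewrite NegzE mulrNz => /eqP; rewrite oppr_eq0 => /eqP /nQ'.
  have [n /eqP Qn nmin] := ex_minnP exQ.
  have n0 : (n > 0)%N by case: n Qn {nmin}; rewrite // mulr1n.
  have nq0 : n.+1%:Q != 0 by rewrite intr_eq0.
  exists (qz (n.+1%:Q^-1)).
    move=> /qz_eq0 /intrP[z Ez].
    have : (z * n.+1%:Z)%:~R = 1%:~R :> rat by rewrite intrM -Ez mulVf.
    move/intr_inj => E; have : absz (z * n.+1%:Z) = 1%N by rewrite E.
    rewrite abszM /= => /eqP; rewrite muln_eq1 => /andP[_ /eqP[]] n00.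
    by rewrite n00 in n0.
  move=> k mk.
  have Ek : k = (k %/ n.+1%:Z)%Z * n.+1%:Z + (k %% n.+1%:Z)%Z by exact: divz_eq.
  have : (k %% n.+1%:Z)%Z < n.+1%:Z by rewrite ltz_pmod.
  have : 0 <= (k %% n.+1%:Z)%Z by rewrite modz_ge0.
  have : m *~ (k %% n.+1%:Z)%Z = 0.
    move: mk; rewrite {1}Ek mulrzDr mulrC mulrzA.
    by rewrite -[m *~ n.+1%:Z]/(m *+ n.+1) Qn mul0rz add0r.
  case Er : (k %% n.+1%:Z)%Z => [[|r]|r] // mr _ rn.
    rewrite Ek Er addr0 -raddfMz; apply/qz_eq0.
    by rewrite -mulrzl intrM mulfK // intr_int.
  have /nmin : Q r by apply/eqP.
  by move: rn; rewrite ltz_nat ltnS => /leq_trans h1 /h1; rewrite ltnn.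
have PG : pmap [set p | exists k : int, p = (m *~ k, d *~ k)].
  split.
  - by exists 0; rewrite !mulr0z.
  - by move=> x y x' y' [k [-> ->]] [k' [-> ->]]; exists (k - k'); rewrite !mulrzBr.
  - by move=> y [k [/esym mk ->]]; exact: dP.
have [g [gB gP]] := pmap_extend PG; exists g; split=> //.
by rewrite (gP m d) //; exists 1; rewrite !mulr1z.
Qed.
End Divisible.

Lemma zmod_morphD (U V : zmodType) (g : U -> V) :
  zmod_morphism g -> {morph g : x y / x + y}.
Proof.
move=> gB x y; have g0 : g 0 = 0 by rewrite -(subrr 0) gB subrr.
by rewrite -[in LHS](opprK y) gB -[- y]sub0r gB g0 sub0r opprK.
Qed.

Section Coinduced.
Context {R : comNzRingType}.
Variable T : Type.

(* Hom_Z(R, QmodZ^T), with (c *: f)(s) = f(s * c) *)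
Record coind := Coind {
  coind_fun :> T -> R -> QmodZ;
  coind_add : forall t, zmod_morphism (coind_fun t)
}.
HB.instance Definition _ := gen_eqMixin coind.
HB.instance Definition _ := gen_choiceMixin coind.

Lemma coindP (f g : coind) : (forall t r, f t r = g t r) -> f = g.
Proof.
case: f g => [f fa] [g ga] /= fg.
have {}fg : f = g by apply: funext => t; apply: funext.
by rewrite -{}fg in ga *; congr Coind; exact: Prop_irrelevance.
Qed.

Fact coind0_add (t : T) : zmod_morphism (fun _ : R => 0 : QmodZ).
Proof. by move=> r s; rewrite subr0. Qed.
Definition coind0 := Coind coind0_add.

Fact coindN_add (f : coind) t : zmod_morphism (fun r => - f t r).
Proof. by move=> r s; rewrite coind_add opprD. Qed.
Definition coindN f := Coind (@coindN_add f).

Fact coindD_add (f g : coind) t : zmod_morphism (fun r => f t r + g t r).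
Proof. by move=> r s; rewrite !coind_add opprD addrACA. Qed.
Definition coindD f g := Coind (@coindD_add f g).

Fact coindZ_add (c : R) (f : coind) t : zmod_morphism (fun r => f t (r * c)).
Proof. by move=> r s; rewrite mulrBl coind_add. Qed.
Definition coindZ c f := Coind (@coindZ_add c f).

Fact coindDA : associative coindD.
Proof. by move=> f g h; apply: coindP => t r /=; rewrite addrA. Qed.
Fact coindDC : commutative coindD.
Proof. by move=> f g; apply: coindP => t r /=; rewrite addrC. Qed.
Fact coind0D : left_id coind0 coindD.
Proof. by move=> f; apply: coindP => t r /=; rewrite add0r. Qed.
Fact coindND : left_inverse coind0 coindN coindD.
Proof. by move=> f; apply: coindP => t r /=; rewrite addNr. Qed.
HB.instance Definition _ :=
  GRing.isZmodule.Build coind coindDA coindDC coind0D coindND.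

Fact coindZA a b f : coindZ a (coindZ b f) = coindZ (a * b) f.
Proof. by apply: coindP => t r /=; rewrite mulrA. Qed.
Fact coindZ1 : left_id 1 coindZ.
Proof. by move=> f; apply: coindP => t r /=; rewrite mulr1. Qed.
Fact coindZDr : right_distributive coindZ +%R.
Proof. by move=> c f g; apply: coindP. Qed.
Fact coindZDl f : {morph coindZ^~ f : a b / a + b}.
Proof.
move=> a b; apply: coindP => t r /=; rewrite mulrDr.
exact: zmod_morphD (coind_add f t) _ _.
Qed.
HB.instance Definition _ :=
  GRing.Zmodule_isLmodule.Build R coind coindZA coindZ1 coindZDr coindZDl.

Lemma coind_injective : injective_module (coind : lmodType R).
Proof.
move=> A B i f iinj.
have ext t : exists g : B -> QmodZ,
    zmod_morphism g /\ forall a, g (i a) = f a t 1.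
  have PG : pmap [set p | exists a, p = (i a, f a t 1)].
    split.
    - by exists 0; rewrite !linear0.
    - move=> x y x' y' [a [-> ->]] [a' [-> ->]].
      by exists (a - a'); rewrite !linearB.
    - move=> y [a [/esym]]; rewrite -(linear0 i) => /iinj -> ->.
      by rewrite linear0.
  have [g [gB gP]] := pmap_extend PG; exists g; split=> // a.
  by apply: gP; exists a.
have [g gP] : {g : T -> B -> QmodZ |
    forall t, zmod_morphism (g t) /\ forall a, g t (i a) = f a t 1}.
  by exists (fun t => projT1 (cid (ext t))) => t; case: cid.
have hadd b t : zmod_morphism (fun r : R => g t (r *: b)).
  by move=> r s; rewrite scalerBl (gP t).1.
pose h b : coind := Coind (hadd b).
have hlin : linear h.
  move=> c x y; apply: coindP => t r /=.
  by rewrite scalerDr (zmod_morphD (gP t).1) scalerA.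
pose hL : {linear B -> coind} := HB.pack h (GRing.isLinear.Build R B coind *:%R h hlin).
exists hL => a; apply: coindP => t r /=.
by rewrite -linearZ_LR (gP t).2 linearZ_LR /= mul1r.
Qed.
End Coinduced.
Arguments coind : clear implicits.

Section InjectiveResolution.
Context {R : comNzRingType}.

Definition hull (M : lmodType R) : lmodType R :=
  coind R {t : M -> QmodZ | zmod_morphism t}.

Section Embedding.
Variable M : lmodType R.

Fact hull_add (m : M) (t : {t : M -> QmodZ | zmod_morphism t}) :
  zmod_morphism (fun r : R => sval t (r *: m)).
Proof. by move=> r s; rewrite scalerBl (svalP t). Qed.

Definition hull_fun (m : M) : hull M := Coind (hull_add m).

Fact hull_fun_lin : linear hull_fun.
Proof.
move=> c x y; apply: coindP => -[t tB] r /=.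
by rewrite scalerDr (zmod_morphD tB) scalerA.
Qed.
HB.instance Definition _ :=
  GRing.isLinear.Build R M (hull M) *:%R hull_fun hull_fun_lin.

Definition embed : {linear M -> hull M} := hull_fun.

Lemma embed_eq0 m : embed m = 0 -> m = 0.
Proof.
move=> m0; apply: contrapT => /QmodZ_cogenerator[g [gB]]; apply.
by have := congr1 (fun f : coind R _ => f (exist _ g gB) 1) m0; rewrite /= scale1r.
Qed.

Lemma embed_inj : injective embed.
Proof. by apply: raddf_inj; exact: embed_eq0. Qed.
End Embedding.

Variable M : lmodType R.

Fixpoint cosyzygy (n : nat) : lmodType R :=
  if n is n'.+1 then quotmod (im (embed (cosyzygy n'))) else M.

Definition inj_diff n : {linear hull (cosyzygy n) -> hull (cosyzygy n.+1)} :=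
  embed (cosyzygy n.+1) \o qpi (im (embed (cosyzygy n))).

Fact inj_diff_exact n x :
  inj_diff n x = 0 <-> exists y, embed (cosyzygy n) y = x.
Proof.
rewrite -in_im -[X in X \in _]subr0 -qpi_eq linear0 /inj_diff /=.
split=> [/embed_eq0 //|E].
by have := congr1 (embed (cosyzygy n.+1) : _ -> _) E; rewrite linear0.
Qed.

Fact inj_exact n x : inj_diff n.+1 x = 0 <-> exists y, inj_diff n y = x.
Proof.
rewrite inj_diff_exact; split=> [[y <-]|[y <-]]; last by eexists.
by have [z <-] := qpi_surj y; exists z.
Qed.

Definition inj_resolution : injective_resolution M :=
  {| ir_obj n := hull (cosyzygy n);
     ir_diff := inj_diff;
     ir_aug := embed M;
     ir_inj n := @coind_injective R _;
     ir_aug_inj := @embed_inj M;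
     ir_exact0 := @inj_diff_exact 0;
     ir_exact := inj_exact |}.
End InjectiveResolution.

Section Ideals.
Context {R : comNzRingType}.
Implicit Types a I m : submodClosed R^o.

Lemma ideal_gen_submod (S : set R) :
  submod_axioms (fun x : R^o =>
    forall I : submodClosed R^o, (forall y, S y -> y \in I) -> x \in I).
Proof.
split=> [I _|x y Sx Sy I SI|c x Sx I SI]; first exact: rpred0.
- by rewrite rpredD ?Sx ?Sy.
- by rewrite rpredZ ?Sx.
Qed.

Definition ideal_gen (S : set R) : submodClosed R^o :=
  submod_of (ideal_gen_submod S).

Lemma ideal_genP S x : x \in ideal_gen S <->
  forall I : submodClosed R^o, (forall y, S y -> y \in I) -> x \in I.
Proof. exact: in_submod_of. Qed.

Definition ideal_pow a (n : nat) : submodClosed R^o :=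
  ideal_gen [set \prod_(i < n) r i | r in [set r : nat -> R | forall i, r i \in a]].

Lemma ideal_pow_decr a n k x : x \in ideal_pow a (n + k) -> x \in ideal_pow a n.
Proof.
move=> /ideal_genP; apply=> _ [r /= ra <-]; apply/ideal_genP => I SI.
rewrite big_split_ord /= mulrC.
apply: (@rpredZ R R^o I _ (\prod_(i < n) r i)).
by apply: SI; exists r.
Qed.

Definition noetherian_ring : Prop :=
  forall I, exists s : seq R, I =i ideal_gen [set` s].

Definition maximal_ideal m : Prop :=
  1 \notin m /\ forall I, {subset m <= I} -> 1 \notin I -> {subset I <= m}.

Definition local_ring : Prop :=
  exists m, maximal_ideal m /\ forall m', maximal_ideal m' -> m' =i m.
End Ideals.
Arguments noetherian_ring R : clear implicits.
Arguments local_ring R : clear implicits.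

Definition cohomology (R : comNzRingType) (C : nat -> lmodType R)
    (d : forall n, {linear C n -> C n.+1}) (n : nat) : lmodType R :=
  subquot (ker (d n))
    (match n return submodClosed (C n) with
     | 0 => zeromod
     | n'.+1 => im (d n')
     end).

Section LocalCohomology.
Context {R : comNzRingType}.
Variable a : submodClosed R^o.

Lemma torsion_submod (M : lmodType R) :
  submod_axioms (fun x : M => exists n, forall c, c \in ideal_pow a n -> c *: x = 0).
Proof.
split; first by exists 0 => c _; exact: scaler0.
- move=> x y [n xn] [k yk]; exists (n + k)%N => c ca; rewrite scalerDr.
  rewrite xn ?yk ?addr0 //; last exact: ideal_pow_decr ca.
  by apply: (@ideal_pow_decr _ _ _ n); rewrite addnC.
- move=> c x [n xn]; exists n => e ea.
  by rewrite scalerA mulrC -scalerA xn ?scaler0.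
Qed.

Definition torsion (M : lmodType R) : submodClosed M := submod_of (torsion_submod M).

Definition Gamma (M : lmodType R) : lmodType R := submod (torsion M).

Section GammaMap.
Variables (M N : lmodType R) (f : {linear M -> N}).

Fact Gamma_map_subproof (x : Gamma M) : f (val x) \in torsion N.
Proof.
have /in_submod_of[n xn] := valP x; apply/in_submod_of; exists n => c ca.
by rewrite -linearZ_LR xn ?linear0.
Qed.

Definition Gamma_fun (x : Gamma M) : Gamma N := Sub (f (val x)) (Gamma_map_subproof x).

Fact Gamma_fun_lin : linear Gamma_fun.
Proof. by move=> c x y; apply: val_inj; rewrite linearP /= !linearP. Qed.
HB.instance Definition _ :=
  GRing.isLinear.Build R (Gamma M) (Gamma N) *:%R Gamma_fun Gamma_fun_lin.

Definition Gamma_map : {linear Gamma M -> Gamma N} := Gamma_fun.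
End GammaMap.

(* H^i_a is the i-th right derived functor of Gamma_a. *)
Definition local_cohomology (i : nat) (M : lmodType R) : lmodType R :=
  let I := inj_resolution M in
  cohomology (fun n => Gamma_map (ir_diff I n)) i.
End LocalCohomology.

(* Supremum in Z u {-oo, +oo}; the supremum of the empty set is -oo. *)
Definition zsup (A : set (\bar int)) : \bar int := supremum -oo%E A.

Lemma zsupP A : supremums A (zsup A).
Proof.
suff [s As] : exists s, supremums A s.
  rewrite /zsup /supremum; case: ifPn => [/eqP ->|_]; last by apply: xgetPex; exists s.
  by split=> [y //|y _]; exact: leNye.
have [unb|nunb] := pselect (forall n : int, exists2 x, A x & (n%:E < x)%E).
  exists +oo%E; split=> [y _|[r||] ub] //; first exact: leey.
  - by have [x Ax] := unb r; rewrite ltNge (ub _ Ax).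
  - by have [x Ax] := unb 0; rewrite ltNge (le_trans (ub _ Ax)) ?leNye.
have [n nA] : exists n : int, forall x, A x -> (x <= n%:E)%E.
  apply: contrapT => h; apply: nunb => n; apply: contrapT => nx; apply: h.
  by exists n => x Ax; rewrite leNgt; apply/negP => nx'; apply: nx; exists x.
pose Q (j : nat) := `[< A (n - j%:Z)%:E >].
have [/ex_minnP[j /asboolP Aj jmin]|nQ] := pselect (exists j, Q j).
  exists (n - j%:Z)%:E; split=> [[k||] Ax|y ub] //; last exact: ub.
  - have := nA _ Ax; rewrite !lee_fin => kn.
    have Ek : n - `|n - k|%N%:Z = k by rewrite gez0_abs ?subr_ge0 // opprB addrC subrK.
    have /jmin : Q `|n - k|%N by apply/asboolP; rewrite Ek.
    by rewrite -lez_nat -{2}Ek lerD2l lerN2.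
  - by have := nA _ Ax; rewrite leye_eq.
  - exact: leNye.
exists -oo%E; split=> [[k||] Ax|y _] //; last exact: leNye.
- exfalso; apply: nQ; exists `|n - k|%N; apply/asboolP.
  have := nA _ Ax; rewrite lee_fin => kn.
  by rewrite gez0_abs ?subr_ge0 // opprB addrC subrK.
- by have := nA _ Ax; rewrite leye_eq.
Qed.

Definition hsup (R : comNzRingType) (X : complex R) : \bar int :=
  zsup [set l%:E | l in [set l : int | ~ trivial_module (homology X l)]].

Definition depth (R : comNzRingType) (a : submodClosed R^o) (X : complex R) :
  \bar int := (- hsup (RHom (quotmod a) X))%E.

(* H^i_a = 0 for i < 0, so only i : nat contributes. *)
Definition cd_module (R : comNzRingType) (a : submodClosed R^o) (M : lmodType R) :
  \bar int :=
  zsup [set i%:Z%:E | i in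
         [set i : nat | ~ trivial_module (local_cohomology a i M)]].

Definition cd (R : comNzRingType) (a : submodClosed R^o) (X : complex R) :
  \bar int :=
  zsup [set (cd_module a (homology X l) - l%:E)%E | l in [set: int]].

(* Main.v *)
From HB Require Import structures.
From mathcomp Require Import all_boot all_order all_algebra.
From mathcomp Require Import boolp classical_sets functions constructive_ereal.
From mathcomp Require Import zify.
Require Import Defs.

(** Write a = (x_1, .., x_n), let RG be the derived a-torsion functor and put
    t = - depth(a, X), so that RHom(R/a, X) has no homology in degrees > t.  The
    homology of RG X in degree m is built from the modules H^i_a(H_l(X)) with
    l - i = m.  Suppose depth(a, X) > cd(a, X): then these modules vanish for
    m <= t, hence RG X has no homology in degrees <= t.  On the other hand
    RHom(R/a, RG X) = RHom(R/a, X) and the homology of RG X is a-torsion, which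
    forces RG X to have no homology in degrees > t either.  So RG X is acyclic,
    hence so is RHom(R/a, X), contrary to depth(a, X) < +oo.  This argument is
    hom_acy_of_local_cohomology.

    Derived torsion has to make sense for unbounded complexes.  For one element
    x it is modelled by the cone of (u_i) |-> (u_(i+1) - x u_i) on finitely
    supported sequences in X, and for a by iterating this construction (tele);
    this only involves exact functors and raises degrees by n.

    - tele computes local cohomology of modules (tele_conc_acy).  The point is
      that over a Noetherian ring an injective module has no higher cohomology
      for it (tele_injective_acy), which is deduced from a divisibility property
      of the module that each step of the construction preserves
      (telc_hdivisible).  Since a cone involves only two consecutive degrees, a
      filtration by truncations then passes from modules to X (tele_acy_le).

    - Multiplication by an element of a is null-homotopic on a projective
      resolution P of R/a (hom_null), so that Hom(P, -) does not distinguish X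
      from its derived torsion (hom_tele_acyP).

    - That RHom(R/a, Y) controls the top of the homology of a torsion complex Y
      (htors_acy_gt) is immediate if Y is bounded above: the elements of its
      top homology module killed by a survive in RHom(R/a, Y).  In general the
      Koszul complex of Y replaces Y, and its homology classes are shown to be
      annihilated by a finite composite of maps W -> RHom(a, W), each of which
      is injective in the relevant degrees (dies_inj).  The composite vanishes
      because the Koszul complex of R is a finite extension of R/a-modules, and
      W -> RHom(a, W) is zero on the latter (bounded_dying, leta_killed). *)

Set Implicit Arguments. Unset Strict Implicit. Unset Printing Implicit Defensive.
Import Order.TTheory GRing.Theory Num.Theory.
Local Open Scope ring_scope.

Definition linmap (R : comNzRingType) (U V : lmodType R) (f : U -> V)
    (fL : linear f) : {linear U -> V} :=
  HB.pack f (GRing.isLinear.Build R U V *:%R f fL).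

(** * Cycles, boundaries and vanishing of homology *)
Section Homology.
Context {R : comNzRingType}.
Implicit Types X : complex R.

(** Quantifying over the degrees of the other end of the differential, of which
    only one matters, avoids identifying X_(m - 1 + 1) with X_m. *)
Definition cyc X m (x : X m) : Prop := forall j, cdiff X m j x = 0.
Definition bnd X m (x : X m) : Prop := exists i (y : X i), cdiff X i m y = x.
Definition acy X m : Prop := forall x : X m, cyc x -> bnd x.

Lemma cycP X m (x : X m) : cyc x <-> cdiff X m (m - 1) x = 0.
Proof.
split=> [//|dx j]; have [->|/eqP nj] := eqVneq j (m - 1); first by [].
by rewrite cdiff_shape // => mE; apply: nj; rewrite mE addrK.
Qed.

Lemma bndP X m (x : X m) : bnd x <-> exists y : X (m + 1), cdiff X (m + 1) m y = x.
Proof.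
split=> [[i [y <-]]|[y <-]]; last by exists (m + 1), y.
have [E|/eqP ni] := eqVneq i (m + 1); first by subst i; exists y.
by exists 0; rewrite linear0 cdiff_shape.
Qed.

Lemma bnd_d X i m (y : X i) : bnd (cdiff X i m y).
Proof. by exists i, y. Qed.

Lemma cyc0 X m : cyc (0 : X m). Proof. by move=> j; rewrite linear0. Qed.
Lemma cycD X m (x y : X m) : cyc x -> cyc y -> cyc (x + y).
Proof. by move=> cx cy j; rewrite linearD cx cy addr0. Qed.
Lemma cycZ X m c (x : X m) : cyc x -> cyc (c *: x).
Proof. by move=> cx j; rewrite linearZ_LR cx scaler0. Qed.
Lemma cycN X m (x : X m) : cyc x -> cyc (- x).
Proof. by move=> cx j; rewrite linearN cx oppr0. Qed.
Lemma cycB X m (x y : X m) : cyc x -> cyc y -> cyc (x - y).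
Proof. by move=> cx cy; apply: cycD => //; apply: cycN. Qed.
Lemma bnd0 X m : bnd (0 : X m). Proof. by exists m, 0; rewrite linear0. Qed.
Lemma bndD X m (x y : X m) : bnd x -> bnd y -> bnd (x + y).
Proof.
by move=> /bndP[u <-] /bndP[v <-]; rewrite -linearD; exact: bnd_d.
Qed.
Lemma bndZ X m c (x : X m) : bnd x -> bnd (c *: x).
Proof. by move=> [i [u <-]]; rewrite -linearZ_LR; exact: bnd_d. Qed.
Lemma bndN X m (x : X m) : bnd x -> bnd (- x).
Proof. by move=> [i [u <-]]; rewrite -linearN; exact: bnd_d. Qed.
Lemma bndB X m (x y : X m) : bnd x -> bnd y -> bnd (x - y).
Proof. by move=> cx cy; apply: bndD => //; apply: bndN. Qed.
Lemma bnd_cyc X m (x : X m) : bnd x -> cyc x.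
Proof. by move=> [i [u <-]] j; rewrite cdiff_comp. Qed.
Lemma bndBl X m (x y : X m) : bnd (x - y) -> bnd y -> bnd x.
Proof. by move=> bxy /(bndD bxy); rewrite subrK. Qed.
Lemma bndBr X m (x y : X m) : bnd (x - y) -> bnd x -> bnd y.
Proof. by move=> bxy /bndB/(_ bxy); rewrite opprB addrC subrK. Qed.

Lemma cyc_ker X l (x : X l) : cyc x <-> x \in ker (cdiff X l (l - 1)).
Proof. by rewrite cycP in_ker. Qed.

Definition hcls X l (x : X l) : homology X l :=
  match pselect (x \in ker (cdiff X l (l - 1))) with
  | left xZ => qpi _ (Sub x xZ)
  | right _ => 0
  end.

Lemma hclsE X l (x : X l) (xZ : x \in ker (cdiff X l (l - 1))) :
  hcls x = qpi _ (Sub x xZ).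
Proof.
by rewrite /hcls; case: pselect => // xZ'; congr (qpi _ _); apply: val_inj.
Qed.

Lemma hcls_surj X l (y : homology X l) : exists2 x : X l, cyc x & hcls x = y.
Proof.
have [[x xZ] <-] := qpi_surj y; exists x; first exact/cyc_ker.
by rewrite hclsE; congr (qpi _ _); apply: val_inj.
Qed.

Lemma hclsP X l c (x y : X l) : cyc x -> cyc y ->
  hcls (c *: x + y) = c *: hcls x + hcls y.
Proof.
move=> cx cy; have cxy : cyc (c *: x + y) by apply: cycD => //; apply: cycZ.
move/cyc_ker: cx => cx; move/cyc_ker: cy => cy; move/cyc_ker: cxy => cxy.
rewrite !hclsE -linearP; congr (qpi _ _); apply: val_inj.
by rewrite linearP.
Qed.

Lemma hcls_eq0 X l (x : X l) : cyc x -> hcls x = 0 <-> bnd x.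
Proof.
move=> /cyc_ker xZ; rewrite hclsE -(linear0 (qpi _)) qpi_eq subr0 in_submod_of.
by rewrite in_im bndP.
Qed.

Lemma trivial_homology X l : trivial_module (homology X l) <-> acy X l.
Proof.
split=> [H0 x cx|aX y]; first exact/hcls_eq0.
by have [x cx <-] := hcls_surj y; apply/(hcls_eq0 cx)/aX.
Qed.
End Homology.

(** * Transport along equalities of degrees *)
Section Transport.
Context {R : comNzRingType}.
Implicit Types X : int -> lmodType R.

(** A cone has components X_(i - 1), whose types differ from those of X_j even
    when i - 1 = j.  A linear map that is total in both degrees lets the
    differential of a cone be written without proofs of such equalities. *)
Definition tr X i j (x : X i) : X j :=
  match pselect (i = j) with
  | left E => ecast k (X k) E x
  | right _ => 0
  end.

Lemma trE X i (x : X i) : tr i x = x.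
Proof. by rewrite /tr; case: pselect => // E; rewrite (Prop_irrelevance E erefl). Qed.

Lemma tr_neq X i j (x : X i) : i <> j -> tr j x = 0.
Proof. by rewrite /tr; case: pselect. Qed.

Fact tr_lin X i j : linear (@tr X i j).
Proof.
move=> c x y; have [E|/eqP n] := eqVneq i j; first by subst j; rewrite !trE.
by rewrite !tr_neq // scaler0 addr0.
Qed.
HB.instance Definition _ X i j :=
  GRing.isLinear.Build R (X i) (X j) *:%R (@tr X i j) (@tr_lin X i j).

Lemma trK X i j (x : X i) : i = j -> tr i (tr j x) = x.
Proof. by move=> <-; rewrite !trE. Qed.
End Transport.
Arguments tr {R} X i j x.

(** * Chain maps, short exact sequences and quasi-isomorphisms *)
Section ChainMaps.
Context {R : comNzRingType}.
Implicit Types X Y Z : complex R.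

Record cmap X Y := CMap {
  cmap_fun :> forall i, {linear X i -> Y i};
  cmapd : forall i j x, cdiff Y i j (cmap_fun i x) = cmap_fun j (cdiff X i j x)
}.

Lemma cyc_map X Y (f : cmap X Y) m (x : X m) : cyc x -> cyc (f m x).
Proof. by move=> cx j; rewrite cmapd cx linear0. Qed.
Lemma bnd_map X Y (f : cmap X Y) m (x : X m) : bnd x -> bnd (f m x).
Proof. by move=> [i [y <-]]; rewrite -cmapd; exact: bnd_d. Qed.

Lemma tr_cmap X Y (f : cmap X Y) i j (x : X i) : f j (tr X i j x) = tr Y i j (f i x).
Proof.
have [E|/eqP n] := eqVneq i j; first by subst j; rewrite !trE.
by rewrite !tr_neq // linear0.
Qed.

Definition cmap_id X : cmap X X := @CMap X X (fun i => idfun) (fun _ _ _ => erefl).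

Definition hsurj X Y (f : cmap X Y) m :=
  forall y, cyc y -> exists2 x, cyc x & bnd (y - f m x).
Definition hinj X Y (f : cmap X Y) m := forall x, cyc x -> bnd (f m x) -> bnd x.
Definition qiso X Y (f : cmap X Y) := forall m, hsurj f m /\ hinj f m.

Lemma qiso_acy X Y (f : cmap X Y) m : qiso f -> acy X m <-> acy Y m.
Proof.
move=> fq; have [fs fi] := fq m; split=> aX x cx.
  by have [y /aX by_ /bndBl] := fs x cx; apply; exact: bnd_map.
by apply: fi => //; apply: aX; exact: cyc_map.
Qed.

Lemma bij_qiso X Y (f : cmap X Y) :
  (forall m, injective (f m)) -> (forall m y, exists x, f m x = y) -> qiso f.
Proof.
move=> fi fs m; split=> [y cy|x cx].
  have [x E] := fs m y; exists x; last by rewrite E subrr; exact: bnd0.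
  by move=> j; apply: (fi j); rewrite -cmapd E cy linear0.
move=> [i [y E]]; have [z Ez] := fs i y; exists i, z; apply: (fi m).
by rewrite -cmapd Ez.
Qed.

Record ses X Y Z (f : cmap X Y) (g : cmap Y Z) : Prop := Ses {
  ses_inj : forall m, injective (f m);
  ses_surj : forall m z, exists y, g m y = z;
  ses_exact : forall m y, g m y = 0 <-> exists x, f m x = y
}.

Section LongExactSequence.
Variables (X Y Z : complex R) (f : cmap X Y) (g : cmap Y Z).
Hypothesis fg : ses f g.

Lemma ses_comp m x : g m (f m x) = 0.
Proof. by apply/(ses_exact fg); exists x. Qed.

(** Exactness of the long homology sequence at H_m(Y). *)
Lemma ses_lift m (y : Y m) : cyc y -> bnd (g m y) ->
  exists2 x, cyc x & bnd (y - f m x).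
Proof.
move=> cy [i [z E]]; have [u Eu] := ses_surj fg z.
have /(ses_exact fg)[x Ex] : g m (y - cdiff Y i m u) = 0.
  by rewrite linearB -cmapd Eu E subrr.
exists x; last by rewrite Ex opprB addrC subrK; exact: bnd_d.
move=> j; apply: (ses_inj fg); rewrite -cmapd Ex linear0 linearB cy cdiff_comp.
by rewrite subrr.
Qed.

Lemma ses_acy m : acy X m -> acy Z m -> acy Y m.
Proof.
move=> aX aZ y cy; have [//|x cx] := ses_lift cy; first exact/aZ/cyc_map.
by move=> /bndBl; apply; apply/bnd_map/aX.
Qed.

Lemma ses_hinj m : acy Z (m + 1) -> hinj f m.
Proof.
move=> aZ x cx /bndP[y E]; have [| i [z Ez]] := aZ (g _ y).
  apply/cycP; rewrite addrK cmapd E ses_comp //.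
have [u Eu] := ses_surj fg z.
have /(ses_exact fg)[v Ev] : g _ (y - cdiff Y i _ u) = 0.
  by rewrite linearB -cmapd Eu Ez subrr.
exists (m + 1), v; apply: (ses_inj fg); rewrite -cmapd Ev linearB E cdiff_comp.
by rewrite subr0.
Qed.

Lemma ses_acy_left m : hsurj g (m + 1) -> acy Y m -> acy X m.
Proof.
move=> gs aY x cx; have /aY/bndP[y Ey] := cyc_map f cx.
have [|z cz [i [u Eu]]] := gs (g _ y).
  by apply/cycP; rewrite addrK cmapd Ey ses_comp.
have [v Ev] := ses_surj fg u.
have /(ses_exact fg)[w Ew] : g _ (y - z - cdiff Y i _ v) = 0.
  by rewrite linearB linearB -cmapd Ev Eu subrr.
exists (m + 1), w; apply: (ses_inj fg).
by rewrite -cmapd Ew !linearB cdiff_comp cz !subr0 Ey.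
Qed.

End LongExactSequence.
End ChainMaps.

(** * Mapping cones *)
Section Cone.
Context {R : comNzRingType}.


Lemma tr_cdiff (X : complex R) i i' j k x : i + k = j + i' ->
  cdiff X j k (tr X i j x) = tr X i' k (cdiff X i i' x).
Proof.
move=> E; have [Eij|/eqP n] := eqVneq i j.
  subst j; have -> : k = i' by lia.
  by rewrite !trE.
by rewrite !tr_neq ?linear0 //; lia.
Qed.

Section Def.
Variables (U V : complex R) (f : cmap U V).

Definition cone_obj (m : int) : lmodType R := (V m * U (m - 1))%type.

Definition cone_fun i j (z : cone_obj i) : cone_obj j :=
  (cdiff V i j z.1 + tr V (i - 1) j (f (i - 1) z.2),
   - cdiff U (i - 1) (j - 1) z.2).

Fact cone_lin i j : linear (@cone_fun i j).
Proof.
move=> c x y; rewrite /cone_fun /= !linearP; congr pair.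
by rewrite /= scalerDr addrACA.
Qed.

Fact cone_shape i j : i <> j + 1 -> forall z, linmap (@cone_lin i j) z = 0.
Proof.
move=> n z; rewrite /= /cone_fun cdiff_shape // tr_neq; last by lia.
by rewrite cdiff_shape ?addr0 ?oppr0 //; lia.
Qed.

Fact cone_comp i j k z : linmap (@cone_lin j k) (linmap (@cone_lin i j) z) = 0.
Proof.
have [E|/eqP n] := eqVneq i (j + 1); last by rewrite (cone_shape n) linear0.
rewrite /= /cone_fun /=; congr pair; last by rewrite linearN cdiff_comp !oppr0.
rewrite linearD cdiff_comp add0r !linearN -cmapd.
have [Ej|/eqP n] := eqVneq j (k + 1).
  by rewrite (@tr_cdiff V (i - 1) (j - 1)) ?subrr //; lia.
by rewrite (cdiff_shape n) /= tr_neq ?subrr //; lia.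
Qed.

Definition cone : complex R := Complex cone_shape cone_comp.

Lemma cone_cycP m (z : cone m) :
  cyc z <-> cyc z.2 /\ cdiff V m (m - 1) z.1 + f (m - 1) z.2 = 0.
Proof.
rewrite cycP /= /cone_fun trE; split=> [Ez|[c E]]; last first.
  by rewrite E c oppr0.
split; last exact: (congr1 fst Ez).
by apply/cycP/oppr_inj; rewrite oppr0; exact: (congr1 snd Ez).
Qed.

Lemma cone_bndP m (z : cone m) : bnd z <->
  exists (u : U m) (v : V (m + 1)),
    cdiff V (m + 1) m v + f m u = z.1 /\ cdiff U m (m - 1) u = - z.2.
Proof.
rewrite bndP; split=> [[[v u] /=]|[u [v [E1 E2]]]].
  rewrite /cone_fun /= => <- /=; exists (tr U (m + 1 - 1) m u), v; split.
    by rewrite tr_cmap.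
  by rewrite opprK (@tr_cdiff U _ (m - 1)) ?trE //; lia.
exists (v, tr U m (m + 1 - 1) u); rewrite /= /cone_fun /= tr_cmap trK; last by lia.
rewrite E1 (@tr_cdiff U _ (m - 1)); last by lia.
by rewrite trE E2 opprK; case: (z).
Qed.

Definition cone_inl : cmap V cone.
Proof.
exists (fun m => linmap (f := fun v => (v, 0) : cone m)
  (fun c x y => f_equal2 pair erefl (esym (etrans (addr0 _) (scaler0 _ c))))).
by move=> i j x; rewrite /= /cone_fun /= !linear0 addr0.
Defined.

Lemma cone_inl_cyc m (v : V m) : cyc ((v, 0) : cone m) <-> cyc v.
Proof.
rewrite cone_cycP /= linear0 addr0; split=> [[_ /cycP] //|cv].
by split; [exact: cyc0 | exact: cv].
Qed.

(** Exactness of the long homology sequence at the cone: a class that vanishes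
    on the U side comes from V. *)
Lemma cone_reduce m (z : cone m) : cyc z -> bnd z.2 ->
  exists2 v, cyc v & bnd (z - cone_inl m v).
Proof.
move=> cz /bndP[u0]; set u := tr U _ m u0.
rewrite -[cdiff U _ _ u0](@trE _ U) -(@tr_cdiff U _ _ m) -/u; last by lia.
move=> E; have bv : bnd (z - cone_inl m (z.1 + f m u)).
  apply/cone_bndP; exists (- u), 0.
  by rewrite /= !linearN linear0 add0r E subr0 opprD addNKr.
exists (z.1 + f m u) => //; apply/cone_inl_cyc.
by have := cycB cz (bnd_cyc bv); rewrite opprB addrC subrK.
Qed.

(** The long exact sequence of the cone around its own homology: the cone sees
    the cokernel of f in degree m and its kernel in degree m - 1. *)
Lemma cone_acyP m : acy cone m <-> hsurj f m /\ hinj f (m - 1).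
Proof.
split=> [ac|[fs fi] z cz].
  split=> [v cv|u cu /bndP[v E]].
    have /ac/cone_bndP[u [w [E1 E2]]] : cyc ((v, 0) : cone m) by apply/cone_inl_cyc.
    exists u; first by apply/cycP; rewrite E2 oppr0.
    by rewrite -[v]E1 addrK; exact: bnd_d.
  have : cyc ((- tr V _ m v, u) : cone m).
    apply/cone_cycP; split=> //=; rewrite linearN (@tr_cdiff V _ (m - 1)); last by lia.
    by rewrite trE E addNr.
  move=> /ac/cone_bndP[w [_ [_ /= E2]]].
  by rewrite -[u]opprK -E2; apply/bndN/bnd_d.
have [cu E] := (cone_cycP z).1 cz.
have bu : bnd z.2.
  apply: fi => //; rewrite -[f _ _]opprK; apply/bndN; exists m, z.1.
  by apply/eqP; rewrite -addr_eq0 E.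
have [v cv] := cone_reduce cz bu.
move=> /bndBl; apply; have [u cu' /bndP[w Ew]] := fs v cv.
apply/cone_bndP; exists u, w; rewrite Ew subrK; split=> //=.
by rewrite oppr0 cu'.
Qed.

Lemma cone_acy m : acy V m -> acy U (m - 1) -> acy cone m.
Proof.
move=> aV aU; apply/cone_acyP; split=> [v cv|u cu _]; last exact: aU.
by exists 0; [exact: cyc0 | rewrite linear0 subr0; exact: aV].
Qed.

Lemma cone_lift m (u : U (m - 1)) : cyc u -> bnd (f _ u) ->
  exists v, cyc ((v, u) : cone m).
Proof.
move=> cu /bndP[v E]; exists (- tr V _ m v); apply/cone_cycP; split=> //=.
rewrite linearN (@tr_cdiff V _ (m - 1)); last by lia.
by rewrite trE E addNr.
Qed.

Lemma cone_cyc2 m (z : cone m) : cyc z -> bnd (f _ z.2).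
Proof.
move=> /cone_cycP[_ E]; rewrite -[f _ _]opprK; apply/bndN; exists m, z.1.
by apply/eqP; rewrite -addr_eq0 E.
Qed.

Lemma cone_bnd2 m (z : cone m) : bnd z -> bnd z.2.
Proof. by move=> /cone_bndP[u [v [_ E]]]; rewrite -[z.2]opprK -E; apply/bndN/bnd_d. Qed.
End Def.

Section Map.
Variables (U V U' V' : complex R) (f : cmap U V) (f' : cmap U' V').
Variables (g : cmap U U') (h : cmap V V').
Hypothesis hf : forall m u, f' m (g m u) = h m (f m u).

Definition cone_map : cmap (cone f) (cone f').
Proof.
exists (fun m => linmap (f := fun z : cone f m => (h m z.1, g (m - 1) z.2) : cone f' m)
  (fun c x y => f_equal2 pair (linearP (h m) c x.1 y.1) (linearP (g (m - 1)) c x.2 y.2))).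
move=> i j z; rewrite /= /cone_fun /= linearD !cmapd !tr_cmap hf.
by congr pair; rewrite linearN.
Defined.

(** The five lemma for the long exact homology sequences of the two cones. *)
Lemma cone_map_qiso : qiso g -> qiso h -> qiso cone_map.
Proof.
move=> gq hq m; have [hs hi] := hq m; have [gs gi] := gq m.
have [gs' gi'] := gq (m - 1); have [hs' hi'] := hq (m - 1).
split=> [z' cz'|z cz bz].
  have [u cu bu] := gs' z'.2 ((cone_cycP z').1 cz').1.
  have [|v0 cvu] := @cone_lift _ _ f m u cu.
    apply: hi'; first exact: cyc_map.
    rewrite -hf; apply: bndBr (cone_cyc2 cz'); rewrite -linearB.
    exact: bnd_map.
  have [||v' cv' bv'] := @cone_reduce _ _ f' m (z' - cone_map m (v0, u)).
  - by apply: cycB => //; exact: cyc_map.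
  - exact: bu.
  have [v cv bv] := hs v' cv'.
  exists ((v0, u) + cone_inl f m v); first by apply: cycD => //; apply/cone_inl_cyc.
  have E : cone_map m (cone_inl f m v) = cone_inl f' m (h m v) by rewrite /= linear0.
  have := bndD bv' (bnd_map (cone_inl f') bv).
  by rewrite linearB addrA subrK linearD E opprD addrA.
have bu : bnd z.2 by apply: gi'; [exact: ((cone_cycP z).1 cz).1 | exact: cone_bnd2 bz].
have [v cv bzv] := cone_reduce cz bu; apply: (bndBl bzv).
have /cone_bndP[u' [w [E1 E2]]] : bnd (cone_inl f' m (h m v)).
  have := bnd_map cone_map bzv; rewrite linearB => /bndBr/(_ bz).
  by rewrite [cone_map _ _]/= linear0.
have [u cu buu] : exists2 u, cyc u & bnd (u' - g m u).
  by apply: gs; apply/cycP; rewrite E2 oppr0.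
have /bndP[w' Ew'] : bnd (v - f m u).
  apply: hi; first by apply: cycB => //; exact: cyc_map.
  rewrite linearB -[h m v]E1 -hf; rewrite -addrA -linearB.
  by apply: bndD; [exact: bnd_d | exact: bnd_map].
apply/cone_bndP; exists u, w'; rewrite Ew' subrK; split=> //=.
by rewrite oppr0 cu.
Qed.
End Map.

Lemma cone_ses (U V U' V' U'' V'' : complex R)
    (f : cmap U V) (f' : cmap U' V') (f'' : cmap U'' V'')
    (g : cmap U U') (h : cmap V V') (g' : cmap U' U'') (h' : cmap V' V'')
    (hf : forall m u, f' m (g m u) = h m (f m u))
    (hf' : forall m u, f'' m (g' m u) = h' m (f' m u)) :
  ses g g' -> ses h h' -> ses (cone_map hf) (cone_map hf').
Proof.
move=> sg sh; split=> m.
- move=> [v u] [v' u'] /= [Ev Eu].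
  by rewrite (ses_inj sh Ev) (ses_inj sg Eu).
- move=> [v u]; have [v' <-] := ses_surj sh v; have [u' <-] := ses_surj sg u.
  by exists (v', u').
- move=> [v u] /=; split=> [[]|[[v' u'] [<- <-]]].
    by move=> /(ses_exact sh)[v' <-] /(ses_exact sg)[u' <-]; exists (v', u').
  by rewrite (ses_comp sh) (ses_comp sg).
Qed.

Definition scal (x : R) (V : complex R) : cmap V V.
Proof.
exists (fun m => linmap (f := fun v : V m => x *: v)
  (fun c u v => etrans (scalerDr x (c *: u) v)
     (congr1 (+%R^~ _) (etrans (scalerA _ _ _)
        (etrans (congr1 ( *:%R^~ u) (mulrC x c)) (esym (scalerA _ _ _))))))).
by move=> i j v; rewrite /= linearZ_LR.
Defined.

End Cone.
Arguments cone_inl {R U V} f.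

(** * Finitely supported sequences and the telescope *)
Section Sequences.
Context {R : comNzRingType}.

Section Module.
Variable M : lmodType R.

Fact fsupp_submod : submod_axioms (V := nat -> M : lmodType R)
  (fun f => exists n, forall i, (n <= i)%N -> f i = 0).
Proof.
split; first by exists 0.
- move=> f g [n fn] [k gk]; exists (n + k)%N => i le.
  by rewrite fctE fn ?gk ?addr0 //; apply: leq_trans le; rewrite (leq_addr, leq_addl).
- by move=> c f [n fn]; exists n => i le; rewrite fctE fn ?scaler0.
Qed.

Definition fseq : lmodType R := submod (submod_of fsupp_submod).

Definition seq_of (f : nat -> M) (F : exists n, forall i, (n <= i)%N -> f i = 0) : fseq :=
  Sub f ((in_submod_of fsupp_submod f).2 F).

Lemma fseqP (f g : fseq) : (forall i, val f i = val g i) -> f = g.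
Proof. by move=> E; apply/val_inj/funext. Qed.

Lemma fseq_supp (f : fseq) : exists n, forall i, (n <= i)%N -> val f i = 0.
Proof. by have /in_submod_of := valP f. Qed.

Lemma fseqDE (f g : fseq) i : val (f + g) i = val f i + val g i. Proof. by []. Qed.
Lemma fseqZE c (f : fseq) i : val (c *: f) i = c *: val f i. Proof. by []. Qed.
Lemma fseqNE (f : fseq) i : val (- f) i = - val f i. Proof. by []. Qed.

Fact shift_subproof (f : fseq) :
  exists n, forall i, (n <= i)%N -> val f i.+1 = 0.
Proof.
by have [n fn] := fseq_supp f; exists n => i le; apply/fn/leqW.
Qed.
Definition shift_fun (f : fseq) : fseq := seq_of (shift_subproof f).

Fact unshift_subproof (f : fseq) :
  exists n, forall i, (n <= i)%N -> (if i is i'.+1 then val f i' else 0) = 0.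
Proof.
by have [n fn] := fseq_supp f; exists n.+1 => -[|i] // le; apply/fn.
Qed.
Definition unshift_fun (f : fseq) : fseq := seq_of (unshift_subproof f).

Fact single_subproof (m : M) (k : nat) :
  exists n, forall i, (n <= i)%N -> (if i == k then m else 0) = 0.
Proof. by exists k.+1 => i le; case: eqP le => // ->; rewrite ltnn. Qed.
Definition single_fun (k : nat) (m : M) : fseq := seq_of (single_subproof m k).

Fact shift_lin : linear shift_fun.
Proof. by move=> c f g; apply: fseqP. Qed.
Fact unshift_lin : linear unshift_fun.
Proof. by move=> c f g; apply: fseqP => -[|i] //=; rewrite !fctE scaler0 addr0. Qed.
Fact single_lin k : linear (single_fun k).
Proof.
move=> c f g; apply: fseqP => i /=; rewrite !fctE; case: eqP => // _.
by rewrite scaler0 addr0.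
Qed.
Fact at0_lin : linear (fun f : fseq => val f 0%N). Proof. by []. Qed.
End Module.


Definition cmapl (X Y : complex R) (f : forall i, X i -> Y i)
    (fl : forall i, linear (f i))
    (fd : forall i j x, cdiff Y i j (f i x) = f j (cdiff X i j x)) : cmap X Y :=
  @CMap _ X Y (fun i => linmap (fl i)) fd.

Section Map.
Variables (M N : lmodType R) (g : {linear M -> N}).
Fact fmap_subproof (f : fseq M) : exists n, forall i, (n <= i)%N -> g (val f i) = 0.
Proof. by have [n fn] := fseq_supp f; exists n => i /fn ->; rewrite linear0. Qed.
Definition fmap (f : fseq M) : fseq N := seq_of (fmap_subproof f).
Fact fmap_lin : linear fmap.
Proof. by move=> c x y; apply: fseqP => i /=; rewrite linearP. Qed.
End Map.

Section Complex.
Variable X : complex R.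

Fact seqc_shape i j : i <> j + 1 -> forall x, linmap (fmap_lin (cdiff X i j)) x = 0.
Proof. by move=> n x; apply: fseqP => k /=; rewrite cdiff_shape. Qed.
Fact seqc_comp i j k x :
  linmap (fmap_lin (cdiff X j k)) (linmap (fmap_lin (cdiff X i j)) x) = 0.
Proof. by apply: fseqP => l /=; rewrite cdiff_comp. Qed.
Definition seqc : complex R := Complex seqc_shape seqc_comp.

Lemma seqc_cyc m (f : seqc m) : cyc f <-> forall i, cyc (val f i).
Proof.
split=> [cf i j|cf j]; last by apply: fseqP => i; exact: cf.
exact: (congr1 (fun g : seqc j => val g i) (cf j)).
Qed.

Lemma seqc_bnd m (f : seqc m) : bnd f <-> forall i, bnd (val f i).
Proof.
split=> [[k [g <-]] i|bf]; first exact: bnd_d.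
have [n fn] := fseq_supp f.
pose h i : X (m + 1) := projT1 (cid ((bndP (val f i)).1 (bf i))).
have hP i : cdiff X (m + 1) m (h i) = val f i by rewrite /h; case: cid.
pose h' i := if (i < n)%N then h i else 0.
have hF : exists k, forall i, (k <= i)%N -> h' i = 0.
  by exists n => i; rewrite leqNgt /h' => /negPf ->.
exists (m + 1), (seq_of hF).
by apply: fseqP => i; rewrite /= /h'; case: ltnP => [_|/fn ->]; rewrite ?linear0.
Qed.

Lemma seqc_acy m : acy X m -> acy seqc m.
Proof. by move=> aX f /seqc_cyc cf; apply/seqc_bnd => i; apply: aX. Qed.

Fact shiftd i j x : cdiff seqc i j (shift_fun x) = shift_fun (cdiff seqc i j x).
Proof. exact: fseqP. Qed.
Definition shift : cmap seqc seqc :=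
  @cmapl seqc seqc _ (fun i => @shift_lin (X i)) shiftd.
Fact unshiftd i j x : cdiff seqc i j (unshift_fun x) = unshift_fun (cdiff seqc i j x).
Proof. by apply: fseqP => -[|k] //=; rewrite linear0. Qed.
Definition unshift : cmap seqc seqc :=
  @cmapl seqc seqc _ (fun i => @unshift_lin (X i)) unshiftd.
Fact singled k i j (x : X i) :
  cdiff seqc i j (single_fun k x) = single_fun k (cdiff X i j x).
Proof. by apply: fseqP => l /=; case: eqP => // _; rewrite linear0. Qed.
Definition single (k : nat) : cmap X seqc :=
  @cmapl X seqc _ (fun i => @single_lin (X i) k) (@singled k).
Definition at0 : cmap seqc X :=
  @cmapl seqc X (fun i f => val f 0%N) (fun i => @at0_lin (X i)) (fun i j x => erefl).

Section Telescope.
Variable x : R.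

Definition tel : cmap seqc seqc.
Proof.
apply: (@cmapl seqc seqc (fun i f => shift i f - x *: f)).
  move=> i c f g; apply: fseqP => k.
  change (c *: val f k.+1 + val g k.+1 - x *: (c *: val f k + val g k) =
    c *: (val f k.+1 - x *: val f k) + (val g k.+1 - x *: val g k)).
  by rewrite scalerDr scalerBr opprD addrACA !scalerA [x * c]mulrC.
by move=> i j f; rewrite linearB linearZ_LR cmapd.
Defined.

Lemma telE m (f : seqc m) i : val (tel m f) i = val f i.+1 - x *: val f i.
Proof. by []. Qed.

(** Derived x-torsion, one degree up.  A sequence in the kernel of the telescope
    map is (u, x u, x^2 u, ..) with u killed by a power of x; its cokernel is
    the cokernel of the localization map at x, the sequence with single entry m
    at position k standing for m / x^(k+1). *)
Definition telc : complex R := cone tel.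
End Telescope.
End Complex.
End Sequences.

(** * Torsion and the telescope *)
Section TelescopeTheory.
Context {R : comNzRingType}.
Implicit Types (X Y : complex R) (x : R) (xs : seq R).

(** Elementwise rather than uniform: the exponent depends on the class. *)
Definition htors x X : Prop := forall m (u : X m), cyc u -> exists k, bnd (x ^+ k *: u).

Lemma scale_exprSr X m (x : R) (k : nat) (u : X m) : x ^+ k *: (x *: u) = x ^+ k.+1 *: u.
Proof. by rewrite scalerA exprSr. Qed.

Lemma bndX X m x (k l : nat) (u : X m) :
  (k <= l)%N -> bnd (x ^+ k *: u) -> bnd (x ^+ l *: u).
Proof. by move=> kl /(bndZ (x ^+ (l - k))); rewrite scalerA -exprD subnK. Qed.

Lemma seqc_htors x X : htors x X -> htors x (seqc X).
Proof.
move=> tX m f /seqc_cyc cf; have [n fn] := fseq_supp f.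
have [k kP] : exists k, forall i, (i < n)%N -> bnd (x ^+ k *: val f i).
  elim: n {fn} => [|n [k kP]]; first by exists 0%N.
  have [l lP] := tX _ _ (cf n); exists (k + l)%N => i.
  rewrite ltnS leq_eqVlt => /orP[/eqP ->|/kP]; last by apply: bndX; rewrite leq_addr.
  by apply: bndX lP; rewrite leq_addl.
exists k; apply/seqc_bnd => i; have [/kP //|/fn E] := ltnP i n.
by rewrite [X in bnd X](_ : _ = x ^+ k *: val f i) // E scaler0; exact: bnd0.
Qed.

Lemma cone_htors x (U V : complex R) (f : cmap U V) :
  htors x U -> htors x V -> htors x (cone f).
Proof.
move=> tU tV m z cz; have [cu _] := (cone_cycP z).1 cz.
have [k bu] := tU _ _ cu.
have [|v cv bv] := @cone_reduce _ _ _ f m (x ^+ k *: z) _ bu; first exact: cycZ.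
have [l blv] := tV _ _ cv; exists (l + k)%N; rewrite exprD -scalerA.
apply: (bndBl (y := x ^+ l *: cone_inl f m v)).
  by rewrite -scalerBr; apply: bndZ.
by rewrite -linearZ_LR; exact: bnd_map.
Qed.

Section OneElement.
Variables (x : R) (X : complex R).

(** x^k - shift^k factors through x - shift, and shift^k kills v. *)
Lemma tel_expr k m (v : seqc X m) : cyc v -> (forall i, (k <= i)%N -> val v i = 0) ->
  exists2 w, cyc w & x ^+ k *: v = tel X x m w.
Proof.
elim: k v => [|k IH] v cv vk.
  exists 0; first exact: cyc0.
  by rewrite linear0; apply: fseqP => i; rewrite fseqZE vk // scaler0.
have [||w cw E] := IH (shift X m v); first exact: cyc_map.
  by move=> i ki; exact: vk.
exists (w - x ^+ k *: v); first by apply: cycB => //; exact: cycZ.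
rewrite linearB linearZ_LR -E -scalerBr -scale_exprSr; congr (_ *: _).
by apply: fseqP => i; rewrite fseqDE fseqNE telE fseqZE opprB addrC subrK.
Qed.

Lemma tel_ker m (u : seqc X m) : cyc u -> bnd (tel X x m u) ->
  forall i, bnd (val u i - x ^+ i *: val u 0%N).
Proof.
move=> cu /seqc_bnd bu; elim=> [|i IH]; first by rewrite scale1r subrr; exact: bnd0.
have := bndD (bu i) (bndZ x IH); rewrite telE scalerBr addrA subrK.
by rewrite scalerA -exprS.
Qed.

Lemma tel_ker_htors m (u : seqc X m) : cyc u -> bnd (tel X x m u) ->
  exists k, bnd (x ^+ k *: u).
Proof.
move=> cu bu; have [n un] := fseq_supp u.
have bn : bnd (x ^+ n *: val u 0%N).
  have := tel_ker cu bu n; rewrite un // sub0r => /bndN.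
  by rewrite opprK.
exists n; apply/seqc_bnd => i.
have bi := bndZ (x ^+ n) (tel_ker cu bu i).
rewrite [X in bnd X](_ : _ = x ^+ n *: val u i) //.
apply: (bndBl (y := x ^+ i *: (x ^+ n *: val u 0%N))); last exact: bndZ.
by move: bi; rewrite scalerBr [x ^+ i *: (x ^+ n *: _)]scalerA mulrC -scalerA.
Qed.

Lemma telc_htors : htors x (telc X x).
Proof.
move=> m z cz; have [cu _] := (cone_cycP z).1 cz.
have [k bu] := tel_ker_htors cu (cone_cyc2 cz).
have [|v cv bv] := @cone_reduce _ _ _ (tel X x) m (x ^+ k *: z) _ bu; first exact: cycZ.
have [n vn] := fseq_supp v; have [w cw E] := tel_expr cv vn.
exists (n + k)%N; rewrite exprD -scalerA.
apply: (bndBl (y := x ^+ n *: cone_inl (tel X x) m v)).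
  by rewrite -scalerBr; apply: bndZ.
rewrite -linearZ_LR E; apply/cone_bndP; exists w, 0.
by split; [rewrite linear0 add0r | rewrite oppr0; exact: cw].
Qed.

(** The next three lemmas identify the homology of the telescope in degree m
    with the x-torsion of H_(m-1)(X), by (v, u) |-> u_0, when H_m(X) = 0. *)
Lemma telc_at0_htors m (z : telc X x m) : cyc z ->
  cyc (val z.2 0%N) /\ exists k, bnd (x ^+ k *: val z.2 0%N).
Proof.
move=> cz; have [cu _] := (cone_cycP z).1 cz; split; first by move/seqc_cyc: cu.
have [k /seqc_bnd bu] := tel_ker_htors cu (cone_cyc2 cz).
by exists k; exact: bu.
Qed.

Lemma telc_at0_inj m (z : telc X x m) : acy X m -> cyc z -> bnd (val z.2 0%N) -> bnd z.
Proof.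
move=> aX cz b0; have [cu _] := (cone_cycP z).1 cz.
have bu : bnd z.2.
  by apply/seqc_bnd => i; apply: (bndBl (tel_ker cu (cone_cyc2 cz) i)); exact: bndZ.
have [v cv /bndBl] := cone_reduce cz bu; apply; apply: bnd_map.
exact: seqc_acy.
Qed.

Lemma telc_at0_surj m (c : X (m - 1)) k : cyc c -> bnd (x ^+ k *: c) ->
  exists2 z : telc X x m, cyc z & val z.2 0%N = c.
Proof.
case: k => [|k] cc bk.
  have [||v cv] := @cone_lift _ _ _ (tel X x) m (single X 0 _ c).
  - exact: cyc_map.
  - by rewrite scale1r in bk; apply: bnd_map; exact: bnd_map.
  by exists (v, single X 0 _ c).
have uF : exists n, forall i, (n <= i)%N -> (if (i <= k)%N then x ^+ i *: c else 0) = 0.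
  by exists k.+1 => i; rewrite ltnNge => /negPf ->.
pose u : seqc X (m - 1) := seq_of uF.
have [||v cv] := @cone_lift _ _ _ (tel X x) m u.
- by apply/seqc_cyc => i /=; case: ifP => _; [exact: cycZ | exact: cyc0].
- apply/seqc_bnd => i; rewrite telE /=.
  have [ik|ki] := ltnP i k; first by rewrite ltnW // scalerA -exprS subrr; exact: bnd0.
  rewrite sub0r; apply: bndN; case: leqP => [ik|_]; last by rewrite scaler0; exact: bnd0.
  by rewrite scalerA -exprS; have -> : i = k by lia.
by exists (v, u); rewrite //= scale1r.
Qed.

(** An abstraction of what the homology of a complex inherits from an injective
    module over a Noetherian ring.  Every fraction u / y^k is the image of some w
    in the module itself, and whatever kills u kills w.  The second half lets the
    property pass to torsion submodules. *)
Definition hdivisible (V : complex R) m : Prop := forall (u : V m) y k, cyc u ->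
  exists w N, [/\ cyc w, forall r, bnd (r *: u) -> bnd (r *: w) &
    bnd (y ^+ (N + k) *: w - y ^+ N *: u)].

(** In the cokernel of the telescope map an entry c at position k equals the
    entry x^N c at position k + N. *)
Lemma tel_single_tors m N k (c : X m) : cyc c -> bnd (x ^+ N *: c) ->
  exists2 w, cyc w & bnd (single X k m c - tel X x m w).
Proof.
elim: N k c => [|N IH] k c cc bN.
  exists 0; first exact: cyc0.
  by rewrite linear0 subr0; apply: bnd_map; rewrite scale1r in bN.
have [||w cw bw] := IH k.+1 (x *: c); first exact: cycZ.
  by rewrite scale_exprSr.
exists (w + single X k.+1 m c); first by apply: cycD => //; exact: cyc_map.
rewrite [X in bnd X](_ : _ = single X k.+1 m (x *: c) - tel X x m w) //.
rewrite [tel X x m (w + _)]linearD opprD addrA addrAC; congr (_ + _).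
rewrite [RHS]linearZ_LR.
apply: fseqP => i; rewrite fseqDE fseqNE telE fseqZE /= eqSS.
by rewrite opprB addrC subrK.
Qed.

(** With w as in the definition of divisibility for k = n + 1, the entry
    x^(n+1) w at position n is killed by moving it to the left, and the rest of
    the entry, being killed by x^N, by moving it to the right. *)
Lemma tel_hsurj m : hdivisible X m -> hsurj (tel X x) m.
Proof.
move=> dX v /seqc_cyc cv; have [n vn] := fseq_supp v.
elim: n v cv vn => [|n IH] v cv vn.
  exists 0; first exact: cyc0.
  rewrite linear0 subr0 [v](_ : _ = 0); first exact: bnd0.
  by apply: fseqP => i; exact: vn.
pose v' : seqc X m := v - single X n m (val v n).
have v'E i : val v' i = if i == n then 0 else val v i.
  by rewrite fseqDE fseqNE /=; case: eqP => [->|]; rewrite ?subrr ?subr0.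
have [||w cw bw] := IH v'.
- by move=> i; rewrite v'E; case: ifP => // _; exact: cyc0.
- by move=> i ni; rewrite v'E; case: eqP => // /eqP nin; apply: vn; lia.
set c := val v n; have cc : cyc c := cv n.
have [y [N [cy _ bN]]] := dX c x n.+1 cc.
have [||w1 cw1 bw1] := @tel_single_tors m N n (c - x ^+ n.+1 *: y).
- by apply: cycB => //; exact: cycZ.
- by rewrite scalerBr scalerA -exprD -opprB; exact: bndN.
have [||w2 cw2 E2] := @tel_expr n.+1 m (single X n m y); first exact: cyc_map.
  by move=> i ni /=; case: eqP ni => // ->; rewrite ltnn.
exists (w + (w1 + w2)); first by apply: cycD => //; exact: cycD.
rewrite [X in bnd X](_ : _ = (v' - tel X x m w) +
  (single X n m (c - x ^+ n.+1 *: y) - tel X x m w1)); first exact: bndD.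
rewrite [tel X x m (w + _)]linearD [tel X x m (w1 + _)]linearD -E2.
rewrite [single X n m (c - _)]linearB [single X n m (_ *: y)]linearZ_LR /v' -/c.
rewrite [v - _ - tel X x m w]addrAC -[_ - tel X x m w1 in RHS]addrA [RHS]addrA subrK.
rewrite [in LHS]opprD [LHS]addrA; congr (_ + _).
by rewrite opprD addrC.
Qed.

Lemma telc_hdivisible m : acy X m -> hdivisible X (m - 1) -> hdivisible (telc X x) m.
Proof.
move=> aX dX z y k cz; have [c0 [t bt]] := telc_at0_htors cz.
have [w [N [cw annw bw]]] := dX _ y k c0.
have [z' cz' Ez'] := telc_at0_surj cw (annw _ bt).
exists z', N; split=> // [r brz|].
  apply: telc_at0_inj => //; first exact: cycZ.
  suff : bnd (r *: val z'.2 0%N) by [].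
  rewrite Ez'; apply: annw.
  by have /seqc_bnd/(_ 0%N) := cone_bnd2 brz.
apply: telc_at0_inj => //; first by apply: cycB; exact: cycZ.
suff : bnd (y ^+ (N + k) *: val z'.2 0%N - y ^+ N *: val z.2 0%N) by [].
by rewrite Ez'.
Qed.
End OneElement.
End TelescopeTheory.

(** * Derived torsion along a sequence of elements *)
Section Telescope.
Context {R : comNzRingType}.
Implicit Types (X Y Z : complex R) (x : R) (xs : seq R).

Section SeqMap.
Variables (X Y : complex R) (f : cmap X Y).

Definition seqc_map : cmap (seqc X) (seqc Y).
Proof.
apply: (@cmapl _ (seqc X) (seqc Y) (fun i => fmap (f i)) (fun i => fmap_lin (f i))).
by move=> i j u; apply: fseqP => k; exact: cmapd.
Defined.

Lemma seqc_map_qiso : qiso f -> qiso seqc_map.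
Proof.
move=> fq m; have [fs fi] := fq m; split=> [u /seqc_cyc cu|u /seqc_cyc cu /seqc_bnd bu].
  have [n un] := fseq_supp u.
  pose w i : X m := projT1 (cid2 (fs _ (cu i))).
  have wP i : cyc (w i) /\ bnd (val u i - f m (w i)) by rewrite /w; case: cid2.
  pose w' i := if (i < n)%N then w i else 0.
  have wF : exists k, forall i, (k <= i)%N -> w' i = 0.
    by exists n => i; rewrite leqNgt /w' => /negPf ->.
  exists (seq_of wF).
    apply/(seqc_cyc (X := X)) => i; rewrite /= /w'.
    by case: ifP => _; [exact: (wP i).1 | exact: cyc0].
  apply/(seqc_bnd (X := Y)) => i; rewrite fseqDE fseqNE /= /w'.
  case: ltnP => [_|/un ->]; first exact: (wP i).2.
  by rewrite linear0 subrr; exact: bnd0.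
by apply/seqc_bnd => i; apply: fi (cu i) (bu i).
Qed.

Lemma tel_map x m u : tel Y x m (seqc_map m u) = seqc_map m (tel X x m u).
Proof.
apply: fseqP => i; rewrite telE.
rewrite -[val (seqc_map m (tel _ _ _ _)) i]/(f m (val (tel X x m u) i)) telE.
by rewrite linearB [f m (x *: _)]linearZ_LR.
Qed.

Definition telc_map x : cmap (telc X x) (telc Y x) := cone_map (@tel_map x).

Lemma telc_map_qiso x : qiso f -> qiso (telc_map x).
Proof. by move=> fq; apply: cone_map_qiso; exact: seqc_map_qiso. Qed.
End SeqMap.

Lemma seqc_ses X Y Z (f : cmap X Y) (g : cmap Y Z) :
  ses f g -> ses (seqc_map f) (seqc_map g).
Proof.
move=> fg; split=> m.
- move=> u v uv; apply: fseqP => i; apply: (ses_inj fg).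
  exact: (congr1 (fun w : fseq _ => val w i) uv).
- move=> u; have [n un] := fseq_supp u.
  pose w i : Y m := projT1 (cid (ses_surj fg (val u i))).
  have wP i : g m (w i) = val u i by rewrite /w; case: cid.
  pose w' i := if (i < n)%N then w i else 0.
  have wF : exists k, forall i, (k <= i)%N -> w' i = 0.
    by exists n => i; rewrite leqNgt /w' => /negPf ->.
  exists (seq_of wF); apply: fseqP => i /=; rewrite /w'.
  by case: ltnP => [_|/un ->]; rewrite ?linear0.
- move=> u; split=> [gu|[v <-]]; last first.
    by apply: fseqP => i; exact: (ses_comp fg).
  have [n un] := fseq_supp u.
  have gui i : g m (val u i) = 0 := congr1 (fun w : fseq _ => val w i) gu.
  pose w i : X m := projT1 (cid ((ses_exact fg (val u i)).1 (gui i))).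
  have wP i : f m (w i) = val u i by rewrite /w; case: cid.
  have wF : exists k, forall i, (k <= i)%N -> w i = 0.
    by exists n => i /un E; apply: (ses_inj fg); rewrite wP E linear0.
  by exists (seq_of wF); apply: fseqP => i /=.
Qed.

Lemma telc_ses X Y Z (f : cmap X Y) (g : cmap Y Z) x :
  ses f g -> ses (telc_map f x) (telc_map g x).
Proof. by move=> fg; apply: cone_ses; exact: seqc_ses. Qed.

(** Derived torsion for the ideal generated by xs, with degrees raised by the
    length of xs. *)
Fixpoint tele xs X : complex R := if xs is x :: xs' then tele xs' (telc X x) else X.

Fixpoint tele_map xs X Y (f : cmap X Y) : cmap (tele xs X) (tele xs Y) :=
  if xs is x :: xs' return cmap (tele xs X) (tele xs Y)
  then tele_map xs' (telc_map f x) else f.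

Lemma tele_map_qiso xs X Y (f : cmap X Y) : qiso f -> qiso (tele_map xs f).
Proof. by elim: xs X Y f => //= x xs IH X Y f fq; apply/IH/telc_map_qiso. Qed.

Lemma tele_ses xs X Y Z (f : cmap X Y) (g : cmap Y Z) :
  ses f g -> ses (tele_map xs f) (tele_map xs g).
Proof. by elim: xs X Y Z f g => //= x xs IH X Y Z f g fg; apply/IH/telc_ses. Qed.

Lemma tele_acy_lt xs X s : (forall m, m < s -> acy X m) ->
  forall m, m < s -> acy (tele xs X) m.
Proof.
elim: xs X => //= x xs IH X aX; apply: IH => m ms.
by apply: cone_acy; apply/seqc_acy/aX; lia.
Qed.

Lemma tele_acy_gt xs X s : (forall m, s < m -> acy X m) ->
  forall m, s + (size xs)%:Z < m -> acy (tele xs X) m.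
Proof.
elim: xs X s => [|x xs IH] X s aX m sm /=; first by apply: aX; rewrite addr0 in sm.
apply: (IH _ (s + 1)) => [k sk|]; last by move: sm => /=; lia.
by apply: cone_acy; apply/seqc_acy/aX; lia.
Qed.

Lemma tele_htors xs X x : htors x X -> htors x (tele xs X).
Proof.
by elim: xs X => //= y xs IH X tX; apply/IH/cone_htors; exact: seqc_htors.
Qed.

Lemma tele_htors_in xs X x : x \in xs -> htors x (tele xs X).
Proof.
elim: xs X => //= y xs IH X; rewrite inE => /orP[/eqP ->|/IH //].
exact/tele_htors/telc_htors.
Qed.

(** A divisible homology module keeps the telescope concentrated in one degree,
    where its homology is the torsion submodule, again divisible. *)
Lemma tele_hdivisible xs X s : hdivisible X s -> (forall m, m <> s -> acy X m) ->
  forall m, m <> s + (size xs)%:Z -> acy (tele xs X) m.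
Proof.
elim: xs X s => [|x xs IH] X s dX aX m sm /=; first by apply: aX; rewrite addr0 in sm.
have aX1 : acy X (s + 1) by apply: aX; lia.
apply: (IH _ (s + 1)) => [|k sk|]; last by move: sm => /=; lia.
  by apply: telc_hdivisible; rewrite ?addrK.
have [->|/eqP ks] := eqVneq k s; last by apply: cone_acy; apply/seqc_acy/aX; lia.
apply/cone_acyP; split; first exact: tel_hsurj.
by move=> u cu _; apply: seqc_acy cu; apply: aX; lia.
Qed.

(** Here xs lists the generators not yet treated: the property is reproduced by
    each telescope, and once xs is empty it is surjectivity on H_l. *)
Definition tlift xs X Y (f : cmap X Y) l :=
  forall u : Y l, cyc u -> (forall x, x \in xs -> exists k, bnd (x ^+ k *: u)) ->
  exists v : X l, [/\ cyc v, forall x, x \in xs -> exists k, bnd (x ^+ k *: v)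
    & bnd (u - f l v)].

Lemma telc_tlift x xs X Y (f : cmap X Y) l : acy X l -> acy Y l ->
  tlift (x :: xs) f (l - 1) -> tlift xs (telc_map f x) l.
Proof.
move=> aX aY ft z cz tz; have [c0 t0] := telc_at0_htors cz.
have [||v [cv tv bv]] := ft (val z.2 0%N) => //.
  move=> y; rewrite inE => /orP[/eqP -> //|/tz [k bk]]; exists k.
  by have /seqc_bnd/(_ 0%N) := cone_bnd2 bk.
have [k bk] := tv x (mem_head _ _).
have [w cw E] := telc_at0_surj cv bk; exists w; split=> //.
  move=> y yxs; have [|j bj] := tv y; first by rewrite inE yxs orbT.
  exists j; apply: telc_at0_inj => //; first exact: cycZ.
  suff : bnd (y ^+ j *: val w.2 0%N) by [].
  by rewrite E.
apply: telc_at0_inj => //; first by apply: cycB => //; exact: cyc_map.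
suff : bnd (val z.2 0%N - f _ (val w.2 0%N)) by [].
by rewrite E.
Qed.

Lemma tele_hsurj xs X Y (f : cmap X Y) s : (forall m, s < m -> acy X m) ->
  (forall m, s < m -> acy Y m) -> tlift xs f s ->
  hsurj (tele_map xs f) (s + (size xs)%:Z).
Proof.
elim: xs X Y f s => [|x xs IH] X Y f s aX aY ft /=.
  rewrite addr0 => u cu; have [//|v [cv _ bv]] := ft u cu.
  by exists v.
have -> : s + (size xs).+1%:Z = s + 1 + (size xs)%:Z by lia.
apply: IH => [m sm|m sm|].
- by apply: cone_acy; apply/seqc_acy/aX; lia.
- by apply: cone_acy; apply/seqc_acy/aY; lia.
- by apply: telc_tlift; rewrite ?addrK //; [apply: aX | apply: aY]; lia.
Qed.
End Telescope.

(** * Modules as complexes *)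
Section Concentrated.
Context {R : comNzRingType}.
Implicit Types M N : lmodType R.

Fact conc_submod M (s q : int) : submod_axioms (fun y : M => q <> s -> y = 0).
Proof.
split=> // [x y x0 y0 /[dup] /x0 -> /y0 ->|c x x0 /x0 ->]; first by rewrite addr0.
by rewrite scaler0.
Qed.

Definition conc_obj M s q : lmodType R := submod (submod_of (conc_submod M s q)).

Definition conc_in M s q (y : M) (H : q <> s -> y = 0) : conc_obj M s q :=
  Sub y ((in_submod_of (conc_submod M s q) y).2 H).

Fact zero_lin (U V : lmodType R) : linear (fun _ : U => 0 : V).
Proof. by move=> c x y; rewrite scaler0 addr0. Qed.

(** The module M in degree s.  Each component is a submodule of M, either M or 0,
    so that elements of degree q are elements of M without a proof of q = s. *)
Definition conc M s : complex R :=
  @Complex R (conc_obj M s)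
    (fun i j => linmap (@zero_lin (conc_obj M s i) (conc_obj M s j)))
    (fun _ _ _ _ => erefl) (fun _ _ _ _ => erefl).

Lemma conc_val0 M s q (u : conc M s q) : q <> s -> val u = 0.
Proof. by have /in_submod_of := valP u. Qed.

Lemma conc_eq0 M s q (u : conc M s q) : val u = 0 -> u = 0.
Proof. by move=> E; exact: val_inj. Qed.

Lemma conc_cyc M s q (u : conc M s q) : cyc u.
Proof. by []. Qed.

Lemma conc_bnd M s q (u : conc M s q) : bnd u <-> val u = 0.
Proof.
split=> [[i [y <-]] //|/conc_eq0 ->]; exact: bnd0.
Qed.

Lemma conc_acy M s q : q <> s -> acy (conc M s) q.
Proof. by move=> qs u _; apply/conc_bnd/conc_val0. Qed.

Section Map.
Variables (M N : lmodType R) (f : {linear M -> N}) (s : int).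

Fact conc_map_subproof q (u : conc M s q) : q <> s -> f (val u) = 0.
Proof. by move=> qs; rewrite conc_val0 ?linear0. Qed.

Fact conc_map_lin q : linear (fun u : conc M s q =>
  conc_in (@conc_map_subproof q u) : conc N s q).
Proof. by move=> c u v; apply: val_inj; rewrite /= !linearP. Qed.

Definition conc_map : cmap (conc M s) (conc N s) :=
  @CMap R (conc M s) (conc N s) (fun q => linmap (@conc_map_lin q))
    (fun i j x => esym (linear0 (linmap (@conc_map_lin j)))).
End Map.

Lemma conc_ses M N (P : lmodType R) (f : {linear M -> N}) (g : {linear N -> P}) s :
  injective f -> (forall z, exists y, g y = z) ->
  (forall y, g y = 0 <-> exists x, f x = y) ->
  ses (conc_map f s) (conc_map g s).
Proof.
move=> fi gs ex; split=> q.
- by move=> u v /(congr1 val) /fi uv; apply: val_inj.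
- move=> z; have [y Ey] := gs (val z).
  have [qs|/eqP qs] := eqVneq q s; last first.
    by exists 0; rewrite linear0; apply/esym/conc_eq0/conc_val0.
  have H : q <> s -> y = 0 by move=> /(_ qs).
  by exists (conc_in H); apply: val_inj.
- move=> y; split=> [/(congr1 val) /ex[x Ex]|[x <-]]; last first.
    by apply: val_inj; apply/ex; exists (val x).
  have H : q <> s -> x = 0.
    by move=> qs; apply: fi; rewrite linear0 Ex conc_val0.
  by exists (conc_in H); apply: val_inj.
Qed.
End Concentrated.

(** * Noetherian rings: injective modules and local cohomology *)
Section LocalCohomology.
Context {R : comNzRingType}.
Hypothesis Rnoeth : noetherian_ring R.
Variables (a : submodClosed R^o) (xs : seq R).
Hypothesis axs : a =i ideal_gen [set` xs].

Lemma scalerC (V : lmodType R) (c c' : R) (v : V) : c *: (c' *: v) = c' *: (c *: v).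
Proof. by rewrite !scalerA mulrC. Qed.

Lemma gen_in (I : submodClosed R^o) (s : seq R) :
  I =i ideal_gen [set` s] -> forall x, x \in s -> x \in I.
Proof. by move=> Is x xs'; rewrite Is; apply/ideal_genP => J; apply. Qed.

Lemma gen_sub (I J : submodClosed R^o) (s : seq R) :
  I =i ideal_gen [set` s] -> (forall x, x \in s -> x \in J) ->
  forall x, x \in I -> x \in J.
Proof. by move=> Is sJ x; rewrite Is => /ideal_genP; apply. Qed.

(** The union of the increasing chain (I : x^k) is finitely generated. *)
Lemma saturation_stable (I : submodClosed R^o) (x : R) :
  exists N, forall k r, x ^+ k * r \in I -> x ^+ N * r \in I.
Proof.
have I0 : 0 \in I := rpred0 I.
have ID r r' : r \in I -> r' \in I -> r + r' \in I by move=> rI; exact: (rpredD rI).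
have IM c r : r \in I -> c * r \in I by exact: (@rpredZ R R^o I c).
have S : submod_axioms (fun r : R^o => exists k, x ^+ k * r \in I).
  split; first by exists 0%N; rewrite mulr0.
  - move=> r r' [k kP] [k' kP']; exists (k + k')%N; rewrite mulrDr; apply: ID.
      by rewrite addnC exprD -mulrA; exact: IM.
    by rewrite exprD -mulrA; exact: IM.
  - by move=> c r [k kP]; exists k; rewrite mulrCA; exact: IM.
have [s sP] := Rnoeth (submod_of S).
have [N NP] : exists N, forall r, r \in s -> x ^+ N * r \in I.
  have : forall r, r \in s -> exists k, x ^+ k * r \in I.
    by move=> r rs; exact: ((in_submod_of S r).1 (gen_in sP rs)).
  elim: s {sP} => [|r s IH] sk; first by exists 0%N.
  have [|N NP] := IH; first by move=> r' r's; apply: sk; rewrite inE r's orbT.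
  have [k kP] := sk _ (mem_head r s); exists (k + N)%N => r'.
  rewrite inE => /orP[/eqP ->|/NP rN]; last by rewrite exprD -mulrA; exact: IM.
  by rewrite addnC exprD -mulrA; exact: IM.
have SN : submod_axioms (fun r : R^o => x ^+ N * r \in I).
  split; first by rewrite mulr0.
  - by move=> r r' h h'; rewrite mulrDr; exact: ID.
  - by move=> c r h; rewrite mulrCA; exact: IM.
exists N => k r kr; apply/(in_submod_of SN).
apply: (gen_sub sP); last by apply/(in_submod_of S); exists k.
by move=> r' /NP ?; apply/(in_submod_of SN).
Qed.

(** Extend the map from the ideal Ann m + (x ^ (N + k)) sending x ^ (N + k) to
    x ^ N m; it is well defined once N is beyond the stable range of the chain
    (Ann m : x ^ k).  The extension is obtained by retracting onto E the pushout
    of E and R along that ideal. *)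
Lemma injective_divides (E : lmodType R) : injective_module E ->
  forall (m : E) x k, exists y N,
    (forall r, r *: m = 0 -> r *: y = 0) /\ x ^+ (N + k) *: y = x ^+ N *: m.
Proof.
move=> injE m x k.
have Jax : submod_axioms (fun r : R^o => r *: m = 0).
  split; first exact: scale0r.
  - by move=> r r' h h'; rewrite scalerDl h h' addr0.
  - by move=> c r h; rewrite -scalerA h scaler0.
have [N NP] := saturation_stable (submod_of Jax) x.
have Sax : submod_axioms (V := (E * R^o)%type) (fun p =>
    exists r j, j *: m = 0 /\ p = (x ^+ N *: (r *: m), - (x ^+ (N + k) * r + j))).
  split.
  - exists 0, 0; rewrite !scale0r; split=> //.
    by rewrite mulr0 addr0 oppr0 scaler0.
  - move=> _ _ [r [j [jm ->]]] [r' [j' [jm' ->]]]; exists (r + r'), (j + j').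
    split; first by rewrite scalerDl jm jm' addr0.
    by congr pair; rewrite ?scalerDl ?scalerDr // -opprD mulrDr addrACA.
  - move=> c _ [r [j [jm ->]]]; exists (c * r), (c * j).
    split; first by rewrite -scalerA jm scaler0.
    congr pair => /=; first by rewrite !scalerA mulrCA mulrA.
    by rewrite /GRing.scale /= mulrN mulrDr mulrCA.
pose S := submod_of Sax; pose B : lmodType R := quotmod S.
have il : linear (fun z : E => qpi S (z, 0)).
  move=> c u v; rewrite -linearP; congr (qpi _ _); congr pair.
  by rewrite /= scaler0 addr0.
have ii : injective (linmap il).
  apply: raddf_inj => z zE.
  have /qpi_eq : qpi S (z, 0) = qpi S 0 by rewrite [RHS]linear0; exact: zE.
  rewrite subr0 => /in_submod_of[r [j [jm [-> E0]]]].
  have Ej : x ^+ (N + k) * r = - j.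
    by apply/eqP; rewrite -addr_eq0; apply/eqP/oppr_inj; rewrite oppr0; exact: (esym E0).
  have /NP/(in_submod_of Jax) : x ^+ (N + k) * r \in submod_of Jax.
    by apply/(in_submod_of Jax); rewrite Ej scaleNr jm oppr0.
  by rewrite -scalerA.
have [g gE] := injE _ _ (linmap il) idfun ii.
pose e : (E * R^o)%type := (0, 1); have eE (c : R) : c *: e = (0, c).
  by rewrite /e; congr pair; rewrite /= ?scaler0 // /GRing.scale /= mulr1.
have geE (c : R) : g (qpi S (c *: e)) = c *: g (qpi S e) by rewrite !linearZ_LR.
exists (g (qpi S e)), N; split=> [r rm|].
  rewrite -geE; suff -> : qpi S (r *: e) = qpi S 0 by rewrite !linear0.
  apply/qpi_eq; rewrite subr0 eE; apply/(in_submod_of Sax).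
  exists 0, (- r); rewrite scaleNr rm oppr0; split=> //.
  by rewrite scale0r scaler0 mulr0 add0r opprK.
rewrite -geE -[RHS](gE (x ^+ N *: m)) /=; congr (g _).
apply/esym/qpi_eq; rewrite eE; apply/(in_submod_of Sax).
exists 1, 0; rewrite scale0r scale1r; split=> //.
by congr pair; rewrite /= ?subr0 // mulr1 addr0 sub0r.
Qed.

Lemma conc_hdivisible (E : lmodType R) s : injective_module E -> hdivisible (conc E s) s.
Proof.
move=> injE u x k _; have [y [N [annY Y]]] := injective_divides injE (val u) x k.
have H : s <> s -> y = 0 by move=> /(_ erefl).
exists (conc_in H), N; split=> // [r /conc_bnd ru|]; apply/conc_bnd.
  exact: annY.
change (x ^+ (N + k) *: y - x ^+ N *: val u = 0).
by rewrite Y subrr.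
Qed.

(** Induction on the sum of the exponents: multiplying u by a generator lowers
    one of them, and an element of a is a combination of generators. *)
Lemma torsionP (M : lmodType R) (u : M) :
  u \in torsion a M <-> forall x, x \in xs -> exists k, x ^+ k *: u = 0.
Proof.
rewrite in_submod_of; split=> [[n un] x xxs|tu].
  exists n; apply: un; apply/ideal_genP => I; apply; exists (fun _ => x) => /=.
    by move=> _; exact: (gen_in axs).
  by rewrite prodr_const card_ord.
have [e eP] : exists e : R -> nat, forall x, x \in xs -> x ^+ e x *: u = 0.
  have {}tu x : exists k, x \in xs -> x ^+ k *: u = 0.
    by case: (boolP (x \in xs)) => [/tu[k kP]|_]; [exists k | exists 0%N].
  by exists (fun x => projT1 (cid (tu x))) => x; case: cid.
have key : forall K (e : R -> nat) (u : M), (\sum_(x <- undup xs) e x <= K)%N ->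
    (forall x, x \in xs -> x ^+ e x *: u = 0) ->
    forall r : nat -> R, (forall i, r i \in a) -> (\prod_(i < K.+1) r i) *: u = 0.
  clear e eP tu u.
  elim=> [|K IH] e u eK eP r ra.
    rewrite big_ord1.
    have ax : submod_axioms (fun r : R^o => r *: u = 0).
      split; first exact: scale0r.
      - by move=> c c' h h'; rewrite scalerDl h h' addr0.
      - by move=> c c' h; rewrite -scalerA h scaler0.
    apply/(in_submod_of ax); apply: (gen_sub axs) (ra 0%N) => x xxs.
    apply/(in_submod_of ax); have := eP x xxs.
    have /eqP -> : e x == 0%N.
      move: eK; rewrite leqn0 sum_nat_seq_eq0 => /allP/(_ x).
      by rewrite mem_undup; exact.
    by rewrite scale1r => ->; rewrite scaler0.
  rewrite big_ord_recr /= -scalerA.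
  set p := \prod_(i < K.+1) _.
  have ax : submod_axioms (fun r : R^o => p *: (r *: u) = 0).
    split; first by rewrite scale0r scaler0.
    - by move=> c c' h h'; rewrite scalerDl scalerDr h h' addr0.
    - by move=> c c' h; rewrite -scalerA scalerC h scaler0.
  apply/(in_submod_of ax); apply: (gen_sub axs) (ra K.+1) => x xxs.
  apply/(in_submod_of ax).
  have [ex0|ex0] := posnP (e x).
    have := eP x xxs; rewrite ex0 scale1r => ->.
    by rewrite !scaler0.
  apply: (IH (fun y => if y == x then (e x).-1 else e y)) => // [|y yxs].
    move: eK; have xu : x \in undup xs by rewrite mem_undup.
    rewrite !(bigD1_seq x) ?undup_uniq //= eqxx.
    rewrite [X in (_ + X <= K)%N](eq_bigr e) => [|y /negPf -> //]; lia.
  case: eqP => [->|_]; last by rewrite scalerC eP // scaler0.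
  by rewrite scalerA -exprSr prednK // eP.
exists (\sum_(x <- undup xs) e x).+1 => c /ideal_genP cI.
have ax : submod_axioms (fun r : R^o => r *: u = 0).
  split; first exact: scale0r.
  - by move=> r r' h h'; rewrite scalerDl h h' addr0.
  - by move=> r r' h; rewrite -scalerA h scaler0.
apply/(in_submod_of ax); apply: cI => _ [r /= ra <-]; apply/(in_submod_of ax).
exact: (key _ e).
Qed.

Lemma trivial_subquot (V : lmodType R) (Z B : submodClosed V) :
  trivial_module (subquot Z B) <-> {subset Z <= B}.
Proof.
split=> [t z zZ|ZB y].
  have /qpi_eq : qpi (submod_of (preim_submod Z B)) (Sub z zZ : submod Z) = qpi _ 0.
    by rewrite linear0; exact: t.
  by rewrite subr0 => /in_submod_of.
have [z <-] := qpi_surj y; rewrite -(linear0 (qpi _)); apply/qpi_eq.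
by rewrite subr0; apply/in_submod_of/ZB/valP.
Qed.

Lemma local_cohomology0 M : trivial_module (local_cohomology a 0 M) ->
  forall u : M, u \in torsion a M -> u = 0.
Proof.
move=> /trivial_subquot tM u tu.
have tE : embed M u \in torsion a (hull M) := Gamma_map_subproof (embed M) (Sub u tu).
have /in_submod_of : Sub (embed M u) tE \in zeromod (V := Gamma a (hull M)).
  apply: tM; apply/in_ker/val_inj.
  apply: (etrans _ (esym (submod_val0 (torsion a _)))).
  by apply/(@inj_diff_exact _ M 0); exists u.
by move/(congr1 val) => /= /embed_eq0.
Qed.

(** As the cosyzygy embeds in the next injective, its torsion elements are the
    cocycles of degree i + 1. *)
Lemma local_cohomologyS M i : trivial_module (local_cohomology a i.+1 M) ->
  forall u : cosyzygy M i.+1, u \in torsion a (cosyzygy M i.+1) ->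
  exists2 w : hull (cosyzygy M i), w \in torsion a _ &
    qpi (im (embed (cosyzygy M i))) w = u.
Proof.
move=> /trivial_subquot tM u tu.
have tE : embed _ u \in torsion a (hull (cosyzygy M i.+1)) :=
  Gamma_map_subproof (embed (cosyzygy M i.+1)) (Sub u tu).
have /in_im[[w tw] Ew] : (Sub (embed _ u) tE : Gamma a (hull (cosyzygy M i.+1)))
    \in im (Gamma_map a (inj_diff M i)).
  apply: tM; apply/in_ker/val_inj.
  apply: (etrans _ (esym (submod_val0 (torsion a _)))).
  by apply/(@inj_diff_exact _ M i.+1); exists u.
exists w => //; apply: (@embed_inj _ (cosyzygy M i.+1)).
exact: (congr1 val Ew).
Qed.
End LocalCohomology.

Section LocalCohomologyVanishing.
Context {R : comNzRingType}.
Hypothesis Rnoeth : noetherian_ring R.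
Variables (a : submodClosed R^o) (xs : seq R).
Hypothesis axs : a =i ideal_gen [set` xs].
Implicit Types (M N : lmodType R) (s : int).

Lemma tele_injective_acy N s m : injective_module N -> m <> s + (size xs)%:Z ->
  acy (tele xs (conc N s)) m.
Proof.
move=> injN; apply: tele_hdivisible; first exact: conc_hdivisible.
by move=> k ks; exact: conc_acy.
Qed.

Lemma conc_tlift M N (f : {linear M -> N}) s :
  (forall u : N, u \in torsion a N -> exists2 w, w \in torsion a M & f w = u) ->
  tlift xs (conc_map f s) s.
Proof.
move=> tf u _ tu; have [|w tw Ew] := tf (val u).
  apply/(torsionP axs) => x xxs; have [k /conc_bnd ku] := tu x xxs.
  by exists k.
have H : s <> s -> w = 0 by move=> /(_ erefl).
exists (conc_in H); split=> // [x xxs|].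
  have /(torsionP axs)/(_ x xxs)[k kw] := tw.
  by exists k; apply/conc_bnd.
by apply/conc_bnd; change (val u - f w = 0); rewrite Ew subrr.
Qed.

Lemma conc_hsurj M N (f : {linear M -> N}) s :
  (forall u : N, u \in torsion a N -> exists2 w, w \in torsion a M & f w = u) ->
  hsurj (tele_map xs (conc_map f s)) (s + (size xs)%:Z).
Proof.
move=> tf; apply: tele_hsurj; last exact: conc_tlift.
- by move=> m sm; apply: conc_acy; lia.
- by move=> m sm; apply: conc_acy; lia.
Qed.

Lemma cosyzygy_ses M k s :
  ses (conc_map (embed (cosyzygy M k)) s)
      (conc_map (qpi (im (embed (cosyzygy M k)))) s).
Proof.
apply: conc_ses; [exact: embed_inj | exact: qpi_surj | move=> y].
by rewrite -in_im -[X in X \in _]subr0 -qpi_eq linear0.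
Qed.

(** Dimension shifting along an injective resolution identifies the homology of
    the telescope with local cohomology: the telescope of an injective module
    has homology in one degree only, where it is the torsion submodule. *)
Lemma tele_conc_acy M s i : trivial_module (local_cohomology a i M) ->
  acy (tele xs (conc M s)) (s + (size xs)%:Z - i%:Z).
Proof.
case: i => [|i] tM.
  (* M has no torsion, so all of its torsion lifts to the zero module. *)
  pose f : {linear submod (zeromod (V := M)) -> M} := val.
  have fs : hsurj (tele_map xs (conc_map f s)) (s + (size xs)%:Z).
    apply: conc_hsurj => u /(local_cohomology0 tM) ->.
    by exists 0; rewrite ?rpred0 ?linear0.
  have a0 m : acy (conc (submod (zeromod (V := M))) s) m.
    by move=> u _; apply/conc_bnd/val_inj; have /in_submod_of := valP (val u).
  rewrite subr0 => u /fs[v cv /bndBl]; apply; apply: bnd_map.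
  apply: (@tele_acy_lt _ xs _ (s + (size xs)%:Z + 1)) cv => //.
  by lia.
have key k : (k <= i)%N ->
    acy (tele xs (conc (cosyzygy M (i - k)%N) s)) (s + (size xs)%:Z - k.+1%:Z).
  elim: k => [|k IH] ki.
    rewrite subn0; apply: (ses_acy_left (tele_ses xs (cosyzygy_ses M i s))).
      rewrite (_ : _ + 1 = s + (size xs)%:Z); last by lia.
      by apply: conc_hsurj; exact: local_cohomologyS.
    by apply: tele_injective_acy; [exact: coind_injective | lia].
  apply: (ses_acy_left (tele_ses xs (cosyzygy_ses M (i - k.+1)%N s))).
    move=> u cu; exists 0; first exact: cyc0.
    rewrite linear0 subr0.
    have := IH (ltnW ki); rewrite (_ : (i - k)%N = (i - k.+1).+1); last by lia.
    rewrite (_ : s + _ - k.+1%:Z = s + (size xs)%:Z - k.+2%:Z + 1); last by lia.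
    by apply.
  by apply: tele_injective_acy; [exact: coind_injective | lia].
by have := key i (leqnn i); rewrite subnn.
Qed.
End LocalCohomologyVanishing.

(** * Truncation *)
Section Subcomplex.
Context {R : comNzRingType}.
Variable X : complex R.

Section Def.
Variable S : forall q, submodClosed (X q).
Hypothesis Sd : forall i j x, x \in S i -> cdiff X i j x \in S j.

Definition csub_d i j (x : submod (S i)) : submod (S j) :=
  Sub (cdiff X i j (val x)) (Sd j (valP x)).
Fact csub_lin i j : linear (@csub_d i j).
Proof. by move=> c x y; apply: val_inj; rewrite /= !linearP. Qed.
Fact csub_shape i j : i <> j + 1 -> forall x, linmap (@csub_lin i j) x = 0.
Proof.
move=> n x; apply: val_inj; apply: etrans (esym (submod_val0 (S j))).
exact: cdiff_shape.
Qed.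
Fact csub_comp i j k x : linmap (@csub_lin j k) (linmap (@csub_lin i j) x) = 0.
Proof.
apply: val_inj; apply: etrans (esym (submod_val0 (S k))); exact: cdiff_comp.
Qed.
Definition csub : complex R := Complex csub_shape csub_comp.

Definition csub_val : cmap csub X :=
  @CMap _ csub X (fun i => val : {linear submod (S i) -> X i}) (fun i j x => erefl).

Lemma csub_cyc m (x : csub m) : cyc x <-> cyc (val x : X m).
Proof.
split=> cx j; last by apply: val_inj; apply: etrans (cx j) (esym (submod_val0 (S j))).
exact: etrans (congr1 val (cx j)) (submod_val0 (S j)).
Qed.

Lemma csub_bnd m (x : csub m) : bnd x <->
  exists2 y : X (m + 1), y \in S (m + 1) & cdiff X (m + 1) m y = val x.
Proof.
rewrite bndP; split=> [[y <-]|[y yS E]]; first by exists (val y); [exact: valP|].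
by exists (Sub y yS); apply: val_inj.
Qed.
End Def.

Section Map.
Variables (S S' : forall q, submodClosed (X q)).
Hypothesis Sd : forall i j x, x \in S i -> cdiff X i j x \in S j.
Hypothesis Sd' : forall i j x, x \in S' i -> cdiff X i j x \in S' j.
Hypothesis SS' : forall q x, x \in S q -> x \in S' q.
Fact csub_map_lin q :
  linear (fun x : submod (S q) => Sub (val x) (SS' (valP x)) : submod (S' q)).
Proof. by move=> c x y; apply: val_inj. Qed.
Fact csub_map_d i j x :
  cdiff (csub Sd') i j (linmap (@csub_map_lin i) x) =
  linmap (@csub_map_lin j) (cdiff (csub Sd) i j x).
Proof. exact: val_inj. Qed.
Definition csub_map : cmap (csub Sd) (csub Sd') :=
  @CMap _ (csub Sd) (csub Sd') (fun q => linmap (@csub_map_lin q)) csub_map_d.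
End Map.

Fact tcyc_submod s q :
  submod_axioms (fun x : X q => (q < s -> x = 0) /\ (q = s -> cyc x)).
Proof.
split; first by split=> // _; exact: cyc0.
- move=> x y [x0 cx] [y0 cy]; split=> [qs|qs]; first by rewrite x0 ?y0 ?addr0.
  by apply: cycD; [exact: cx | exact: cy].
- move=> c x [x0 cx]; split=> [qs|qs]; first by rewrite x0 ?scaler0.
  by apply: cycZ; exact: cx.
Qed.

Fact tbnd_submod s q :
  submod_axioms (fun x : X q => (q < s -> x = 0) /\ (q = s -> bnd x)).
Proof.
split; first by split=> // _; exact: bnd0.
- move=> x y [x0 cx] [y0 cy]; split=> [qs|qs]; first by rewrite x0 ?y0 ?addr0.
  by apply: bndD; [exact: cx | exact: cy].
- move=> c x [x0 cx]; split=> [qs|qs]; first by rewrite x0 ?scaler0.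
  by apply: bndZ; exact: cx.
Qed.

Definition tcyc s q : submodClosed (X q) := submod_of (tcyc_submod s q).
Definition tbnd s q : submodClosed (X q) := submod_of (tbnd_submod s q).

Fact trunc_d s i j (x : X i) : (i < s -> x = 0) -> (i = s -> cyc x) ->
  (j < s -> cdiff X i j x = 0) /\ (j = s -> bnd (cdiff X i j x)).
Proof.
move=> x0 cx; split=> [js|_]; last exact: bnd_d.
have [E|/eqP n] := eqVneq i (j + 1); last by rewrite cdiff_shape.
have [is_|/eqP ns] := eqVneq i s; first exact: cx.
by rewrite x0 ?linear0 //; lia.
Qed.

Fact tcyc_d s i j x : x \in tcyc s i -> cdiff X i j x \in tcyc s j.
Proof.
move=> /in_submod_of[x0 cx]; have [d0 db] := @trunc_d s i j x x0 cx.
by apply/in_submod_of; split=> // /db /bnd_cyc.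
Qed.

Fact tbnd_d s i j x : x \in tbnd s i -> cdiff X i j x \in tbnd s j.
Proof.
move=> /in_submod_of[x0 cx]; apply/in_submod_of; apply: trunc_d => // /cx.
exact: bnd_cyc.
Qed.

(** Both are subcomplexes of X, so that the modules H_l(X) themselves, rather than
    isomorphic copies, are the successive quotients. *)
Definition trunc_ge s := csub (@tcyc_d s).
Definition trunc_gt s := csub (@tbnd_d s).

Definition trunc_gt_ge s : cmap (trunc_gt s) (trunc_ge s).
Proof.
apply: csub_map => q x /in_submod_of[x0 bx]; apply/in_submod_of.
by split=> // /bx /bnd_cyc.
Defined.

Definition trunc_ge_gt s : cmap (trunc_ge (s + 1)) (trunc_gt s).
Proof.
apply: csub_map => q x /in_submod_of[x0 bx]; apply/in_submod_of.
split=> qs; first by apply: x0; lia.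
by rewrite x0; [exact: bnd0 | lia].
Defined.

Lemma trunc_ge_gt_qiso s : qiso (trunc_ge_gt s).
Proof.
move=> m; split=> [y /csub_cyc cy|x /csub_cyc cx /csub_bnd[y yB E]].
  have /in_submod_of[y0 by_] := valP y.
  have [sm|ms] := ltP s m.
    have yA : val y \in tcyc (s + 1) m.
      by apply/in_submod_of; split=> // ms; lia.
    exists (Sub (val y) yA); first by apply/csub_cyc.
    by rewrite [X in bnd X](_ : _ = 0); [exact: bnd0 | apply: val_inj; rewrite /= subrr].
  exists 0; first exact: cyc0.
  rewrite linear0 subr0; apply/csub_bnd.
  have [ms'|ms'] := ltP m s.
    by exists 0; rewrite ?rpred0 // linear0 y0.
  have /by_/bndP[z Ez] : m = s by lia.
  by exists z => //; apply/in_submod_of; split=> ?; lia.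
have /in_submod_of[x0 _] := valP x; apply/csub_bnd.
have [ms|sm] := ltP m (s + 1).
  by exists 0; rewrite ?rpred0 // linear0 x0.
by exists y => //; apply/in_submod_of; split=> ?; lia.
Qed.

Lemma trunc_ge_qiso s : (forall m, m < s -> acy X m) -> qiso (csub_val (@tcyc_d s)).
Proof.
move=> aX m; split=> [y cy|x /csub_cyc cx /bndP[y Ey]].
  have [ms|sm] := ltP m s.
    exists 0; first exact: cyc0.
    by rewrite [csub_val _ _ _]linear0 subr0; exact: aX.
  have yA : y \in tcyc s m by apply/in_submod_of; split=> // ?; lia.
  by exists (Sub y yA); [apply/csub_cyc | rewrite subrr; exact: bnd0].
have /in_submod_of[x0 _] := valP x; apply/csub_bnd.
have [ms|sm] := ltP m s; first by exists 0; rewrite ?rpred0 // linear0 x0.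
by exists y => //; apply/in_submod_of; split=> ?; lia.
Qed.

Lemma trunc_ge_acy_lt s m : m < s -> acy (trunc_ge s) m.
Proof.
move=> ms x _; have /in_submod_of[/(_ ms) x0 _] := valP x.
by rewrite (_ : x = 0); [exact: bnd0 | apply: val_inj; rewrite x0 submod_val0].
Qed.

Lemma trunc_ge_acy s m : (s <= m -> acy X m) -> acy (trunc_ge s) m.
Proof.
have [ms _|sm /(_ isT) aX] := ltP m s; first exact: trunc_ge_acy_lt.
move=> x /csub_cyc /aX/bndP[y Ey]; apply/csub_bnd; exists y => //.
by apply/in_submod_of; split=> ?; lia.
Qed.

Section Quotient.
Variable s : int.

Fact tr_cyc q (x : trunc_ge s q) : cyc (tr X q s (val x)).
Proof.
have /in_submod_of[_ cx] := valP x.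
have [E|/eqP n] := eqVneq q s; last by rewrite tr_neq //; exact: cyc0.
by subst q; rewrite trE; exact: cx.
Qed.

Fact trunc_cls_subproof q (x : trunc_ge s q) : q <> s -> hcls (tr X q s (val x)) = 0.
Proof. by move=> qs; rewrite tr_neq //; apply/hcls_eq0; [exact: cyc0 | exact: bnd0]. Qed.

Definition trunc_cls_fun q (x : trunc_ge s q) : conc (homology X s) s q :=
  conc_in (@trunc_cls_subproof q x).

Fact trunc_cls_lin q : linear (@trunc_cls_fun q).
Proof.
move=> c x y; apply: val_inj.
change (hcls (tr X q s (c *: val x + val y)) =
  c *: hcls (tr X q s (val x)) + hcls (tr X q s (val y))).
by rewrite linearP hclsP //; exact: tr_cyc.
Qed.

Fact trunc_cls_d i j (x : trunc_ge s i) :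
  0 = linmap (@trunc_cls_lin j) (cdiff (trunc_ge s) i j x).
Proof.
apply: val_inj; apply: etrans (submod_val0 _) (esym _).
apply/hcls_eq0; first exact: tr_cyc.
have [E|/eqP n] := eqVneq j s; last by rewrite tr_neq //; exact: bnd0.
by subst j; rewrite trE; exact: bnd_d.
Qed.

Definition trunc_cls : cmap (trunc_ge s) (conc (homology X s) s) :=
  @CMap _ (trunc_ge s) (conc (homology X s) s)
    (fun q => linmap (@trunc_cls_lin q)) trunc_cls_d.

Lemma trunc_ses : ses (trunc_gt_ge s) trunc_cls.
Proof.
split=> q.
- by move=> x y /(congr1 val) xy; apply: val_inj.
- move=> y; have [qs|/eqP qs] := eqVneq q s; last first.
    by exists 0; rewrite linear0; apply/esym/conc_eq0/conc_val0.
  subst q; have [x cx Ex] := hcls_surj (val y).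
  have xA : x \in tcyc s s by apply/in_submod_of; split=> //; rewrite ltxx.
  by exists (Sub x xA); apply: val_inj; rewrite /= trE.
- move=> y; split=> [/(congr1 val) Ey|[x <-]].
    have yB : val y \in tbnd s q.
      have /in_submod_of[y0 cy] := valP y; apply/in_submod_of; split=> // qs.
      subst q; apply/(hcls_eq0 (cy erefl)).
      have := etrans Ey (submod_val0 _); by rewrite /= trE.
    by exists (Sub (val y) yB); apply: val_inj.
  apply: val_inj; apply: etrans (esym (submod_val0 _)).
  apply/hcls_eq0; first exact: tr_cyc.
  have /in_submod_of[x0 bx] := valP x.
  have [E|/eqP n] := eqVneq q s; last by rewrite tr_neq //; exact: bnd0.
  by subst q; rewrite trE; exact: bx.
Qed.
End Quotient.
End Subcomplex.

Section Devissage.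
Context {R : comNzRingType}.
Hypothesis Rnoeth : noetherian_ring R.
Variables (a : submodClosed R^o) (xs : seq R).
Hypothesis axs : a =i ideal_gen [set` xs].

(** Filter X by its truncations.  In degrees <= t + size xs only finitely many
    homology modules matter, as the telescope does not lower degrees. *)
Lemma tele_acy_le (X : complex R) (t : int) : D_plus X ->
  (forall l (i : nat), - t <= i%:Z - l ->
     trivial_module (local_cohomology a i (homology X l))) ->
  forall m, m <= t + (size xs)%:Z -> acy (tele xs X) m.
Proof.
move=> [n Xn] Xlc.
have conc_tele l m : m <= t + (size xs)%:Z -> acy (tele xs (conc (homology X l) l)) m.
  move=> mt; have [lm|ml] := ltP (l + (size xs)%:Z) m.
    by apply: (tele_acy_gt (s := l)) => // q lq; apply: conc_acy; lia.
  have -> : m = l + (size xs)%:Z - (absz (l + (size xs)%:Z - m)%R)%:Z by lia.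
  by apply: (tele_conc_acy Rnoeth axs); apply: Xlc; lia.
have key k l : t + (size xs)%:Z < l + k%:Z ->
    forall m, m <= t + (size xs)%:Z -> acy (tele xs (trunc_ge X l)) m.
  elim: k l => [|k IH] l tl m mt.
    by apply: (tele_acy_lt (s := l)); [exact: trunc_ge_acy_lt | lia].
  apply: (ses_acy (tele_ses xs (trunc_ses X l))); last exact: conc_tele.
  apply/(qiso_acy m (tele_map_qiso xs (@trunc_ge_gt_qiso _ X l))).
  by apply: IH => //; lia.
move=> m mt; have aX l : l < n -> acy X l by move=> /Xn/trivial_homology.
apply/(qiso_acy m (tele_map_qiso xs (trunc_ge_qiso aX))).
by apply: (key (absz (t + (size xs)%:Z - n)%R).+1) => //; lia.
Qed.
End Devissage.

(** * Homomorphisms out of a projective resolution *)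
Lemma dependent_recursion (A : nat -> Type) (I : forall p, A p -> Prop)
    (Q : forall p, A p -> A p.+1 -> Prop) (a0 : A 0%N) :
  I 0%N a0 -> (forall p a, I p a -> exists b, I p.+1 b /\ Q p a b) ->
  exists s : forall p, A p, s 0%N = a0 /\ forall p, I p (s p) /\ Q p (s p) (s p.+1).
Proof.
move=> I0 step.
pose next p (a : {a : A p | I p a}) : {b : A p.+1 | I p.+1 b} :=
  let b := cid (step p (sval a) (svalP a)) in exist _ (projT1 b) (projT2 b).1.
pose s := fix s p : {a : A p | I p a} :=
  if p is p'.+1 then next p' (s p') else exist _ a0 I0.
exists (fun p => sval (s p)); split=> // p; split; first exact: svalP.
by rewrite /= /next; case: cid => b [].
Qed.

Section HomComplex.
Context {R : comNzRingType}.

(** Lifting through a linear map that need not be onto. *)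
Lemma projective_lift (Q U V : lmodType R) (g : {linear Q -> V}) (t : {linear U -> V}) :
  projective_module Q -> (forall x, exists u, t u = g x) ->
  exists h : {linear Q -> U}, forall x, t (h x) = g x.
Proof.
move=> projQ gt.
have gi x : g x \in im t by apply/in_im.
have ti u : t u \in im t by apply/in_im; exists u.
have gl : linear (fun x => Sub (g x) (gi x) : submod (im t)).
  by move=> c x y; apply: val_inj; rewrite /= !linearP.
have tl : linear (fun u => Sub (t u) (ti u) : submod (im t)).
  by move=> c x y; apply: val_inj; rewrite /= !linearP.
have [|h hP] := projQ _ _ (linmap tl) (linmap gl).
  by move=> [y yi]; have /in_im[u Eu] := yi; exists u; apply: val_inj.
by exists h => x; exact: (congr1 val (hP x)).
Qed.

Lemma exprN1S (j : int) : (-1) ^+ absz (j + 1) = - (-1) ^+ absz j :> R.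
Proof.
case: j => [n|[|n]].
- by rewrite -PoszD addn1 !absz_nat exprS mulN1r.
- by rewrite /= expr1 opprK.
- have -> : Negz n.+1 + 1 = Negz n by lia.
  by rewrite /= [in RHS]exprS mulN1r opprK.
Qed.

Variables (M : lmodType R) (P : projective_resolution M).
Implicit Types X Y Z V W : complex R.

Definition homc X : complex R := hom_complex (@pr_diff_comp R M P) X.

Lemma hom_index X m (f : homc X m) p q q' x : q = q' -> tr X q q' (f p q x) = f p q' x.
Proof. by move=> <-; rewrite trE. Qed.

Lemma hom_diffE X i j (f : homc X i) p q x : i = j + 1 ->
  (cdiff (homc X) i j f : homc X j) p q x =
  cdiff X (q + 1) q (f p (q + 1) x)
  - (-1) ^+ `|i|%N *: hom_precomp (@pr_diff R M P) f q x.
Proof. by move=> E; subst i; rewrite /= /hom_dfun eqxx. Qed.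

Lemma hom_trE X i j (f : homc X i) p q x : i = j ->
  (tr (homc X) i j f : homc X j) p q x = f p q x.
Proof. by move=> E; subst j; rewrite trE. Qed.

Lemma cdiff_index X m (f : homc X m) p q q' k x : q = q' ->
  cdiff X q k (f p q x) = cdiff X q' k (f p q' x).
Proof. by move=> ->. Qed.

Section Map.
Variables (X Y : complex R) (f : cmap X Y).
Fact hom_map_lin0 n (g : homc X n) p q : linear (fun x => f q (g p q x)).
Proof. by move=> c x y; rewrite hom_lin linearP. Qed.
Fact hom_map_shape n (g : homc X n) p q : q <> p%:Z + n -> forall x, f q (g p q x) = 0.
Proof. by move=> h x; rewrite hom_shape ?linear0. Qed.
Definition hom_map_fun n (g : homc X n) : homc Y n :=
  HomObj (hom_map_lin0 g) (@hom_map_shape n g).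
Fact hom_map_lin n : linear (@hom_map_fun n).
Proof. by move=> c g h; apply: hom_objP => p q x; rewrite /= linearP. Qed.
Fact hom_map_d i j g :
  cdiff (homc Y) i j (linmap (@hom_map_lin i) g) =
  linmap (@hom_map_lin j) (cdiff (homc X) i j g).
Proof.
have [E|/eqP n] := eqVneq i (j + 1); last by rewrite !cdiff_shape ?linear0.
apply: hom_objP => p q x; rewrite [LHS]hom_diffE //.
transitivity (f q ((cdiff (homc X) i j g : homc X j) p q x)); last by [].
rewrite hom_diffE // [RHS]linearB [f q (_ *: _)]linearZ_LR -cmapd.
congr (_ - _ *: _).
by case: p x => [|p] x //=; rewrite linear0.
Qed.
Definition hom_map : cmap (homc X) (homc Y) :=
  @CMap _ (homc X) (homc Y) (fun n => linmap (@hom_map_lin n)) hom_map_d.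

Lemma hom_mapE n g p q x : (hom_map n g : homc Y n) p q x = f q (g p q x).
Proof. by []. Qed.

Fact hom_of_lin m (h : forall p : nat, {linear P p -> X (p%:Z + m)}) p q :
  linear (fun x => tr X (p%:Z + m) q (h p x)).
Proof. by move=> c x y; rewrite !linearP. Qed.
Fact hom_of_shape m (h : forall p : nat, {linear P p -> X (p%:Z + m)}) p q :
  q <> p%:Z + m -> forall x, tr X (p%:Z + m) q (h p x) = 0.
Proof. by move=> n x; rewrite tr_neq // => E; apply: n. Qed.
Definition hom_of m (h : forall p : nat, {linear P p -> X (p%:Z + m)}) : homc X m :=
  HomObj (hom_of_lin h) (@hom_of_shape m h).

(** Elementwise liftability suffices, as each P_p is projective. *)
Lemma hom_map_lift m (k : homc Y m) :
  (forall (p : nat) x, exists u, f (p%:Z + m) u = k p (p%:Z + m) x) ->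
  exists h, hom_map m h = k.
Proof.
move=> kf.
have {}kf (p : nat) : exists h : {linear P p -> X (p%:Z + m)},
    forall x, f _ (h x) = k p (p%:Z + m) x.
  exact: (@projective_lift (P p) (X (p%:Z + m)) (Y (p%:Z + m))
    (linmap (@hom_lin _ _ _ _ k p (p%:Z + m))) (f _) (@pr_proj _ _ P p) (kf p)).
pose h p := projT1 (cid (kf p)).
have hP p x : f _ (h p x) = k p (p%:Z + m) x by rewrite /h; case: cid.
exists (hom_of h); apply: hom_objP => p q x; rewrite hom_mapE /= tr_cmap hP.
have [<-|/eqP n] := eqVneq (p%:Z + m) q; first by rewrite trE.
by rewrite tr_neq // hom_shape // => E; apply: n.
Qed.
End Map.

Lemma hom_ses X Y Z (f : cmap X Y) (g : cmap Y Z) :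
  ses f g -> ses (hom_map f) (hom_map g).
Proof.
move=> fg; split=> m.
- move=> u v uv; apply: hom_objP => p q x; apply: (ses_inj fg).
  exact: (congr1 (fun w : homc Y m => w p q x) uv).
- by move=> z; apply: hom_map_lift => p x; exact: (ses_surj fg).
- move=> y; split=> [gy|[x <-]]; last first.
    by apply: hom_objP => p q u; exact: (ses_comp fg).
  apply: hom_map_lift => p x; apply/(ses_exact fg).
  exact: (congr1 (fun w : homc Z m => w p (p%:Z + m) x) gy).
Qed.

End HomComplex.
Arguments homc {R M} P X.
Arguments hom_map {R M} P {X Y} f.

Section HomVanishing.
Context {R : comNzRingType}.
Variables (M : lmodType R) (P : projective_resolution M).
Implicit Types X Y Z U V W : complex R.

Lemma hom_cyc_eq Z m (f : homc P Z m) p q x : cyc f ->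
  cdiff Z (q + 1) q (f p (q + 1) x) =
  (-1) ^+ absz m *: hom_precomp (@pr_diff R M P) f q x.
Proof.
move=> cf; have := congr1 (fun g : homc P Z (m - 1) => g p q x) (cf (m - 1)).
by rewrite hom_diffE ?subrK // => /eqP; rewrite subr_eq0 => /eqP.
Qed.

(** Lift f through the differential of Z one projective at a time: beyond P_0,
    the obstructions are cycles of Z of degree > m. *)
Lemma hom_bnd Z m (f : homc P Z m) : (forall q, m < q -> acy Z q) -> cyc f ->
  (forall x, bnd (f 0%N m x)) -> bnd f.
Proof.
move=> aZ cf f0; pose e : R := (-1) ^+ absz m.
have ee : e * e = 1 by rewrite /e -expr2 sqrr_sign.
pose A (p : nat) := {linear P p -> Z (p%:Z + (m + 1))}.
(* The invariant makes the next right-hand side a cycle. *)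
pose I p (h : A p) := forall y, cdiff Z _ (p%:Z + m) (h (pr_diff P p y)) =
  f p (p%:Z + m) (pr_diff P p y).
pose Q p (h : A p) (h' : A p.+1) := forall y, cdiff Z _ (p.+1%:Z + m) (h' y) =
  f p.+1 (p.+1%:Z + m) y - e *: tr Z _ (p.+1%:Z + m) (h (pr_diff P p y)).
have [h0 h0P] : exists h0 : A 0%N,
    forall x, cdiff Z _ (0%:Z + m) (h0 x) = f 0%N (0%:Z + m) x.
  apply: (@projective_lift _ (P 0%N) (Z _) (Z _)
    (linmap (@hom_lin _ _ _ _ f 0%N (0%:Z + m))) (cdiff Z _ _) (@pr_proj _ _ P 0%N)) => x.
  rewrite /= (_ : 0%:Z + m = m); last by lia.
  rewrite (_ : 0%:Z + (m + 1) = m + 1); last by lia.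
  exact/bndP.
have [||s [s0 sP]] := @dependent_recursion A I Q h0.
- by move=> y; rewrite h0P.
- move=> p h Ih.
  pose g : P p.+1 -> Z (p.+1%:Z + m) := fun y =>
    f p.+1 (p.+1%:Z + m) y - e *: tr Z _ (p.+1%:Z + m) (h (pr_diff P p y)).
  have gl : linear g.
    move=> c x y; rewrite /g [pr_diff P p _]linearP [h _]linearP [tr _ _ _ _]linearP.
    by rewrite hom_lin scalerDr opprD addrACA scalerBr scalerC.
  have [|h' h'P] := @projective_lift _ (P p.+1) (Z (p.+1%:Z + (m + 1))) (Z (p.+1%:Z + m))
      (linmap gl) (cdiff Z _ _) (@pr_proj _ _ P p.+1).
    move=> y /=; rewrite (_ : p.+1%:Z + (m + 1) = p.+1%:Z + m + 1); last by lia.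
    apply/bndP; apply: aZ; first by lia.
    apply/cycP; rewrite /g linearB linearZ_LR.
    rewrite (@tr_cdiff _ Z _ (p%:Z + m)); last by lia.
    rewrite Ih hom_index; last by lia.
    rewrite (@cdiff_index _ _ _ _ _ _ _ _ (p.+1%:Z + m - 1 + 1)); last by lia.
    by rewrite hom_cyc_eq // -/e /= subrr.
  exists h'; split=> // y; rewrite h'P /= /g.
  by rewrite pr_diff_comp [h 0]linear0 [tr _ _ _ 0]linear0 scaler0 subr0.
apply/bndP; exists (hom_of s); apply: hom_objP => p q x.
have [Eq|/eqP n] := eqVneq q (p%:Z + m); last by rewrite !hom_shape.
subst q; rewrite hom_diffE // exprN1S -/e scaleNr opprK /=.
rewrite (@tr_cdiff _ Z _ (p%:Z + m)); last by lia.
rewrite trE; case: p x => [|p] x /=; first by rewrite s0 h0P scaler0 addr0.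
by rewrite (sP p).2 subrK.
Qed.

Lemma hom_acy Z m : (forall q, m <= q -> acy Z q) -> acy (homc P Z) m.
Proof.
move=> aZ f cf; apply: hom_bnd => // [q mq|x]; first by apply: aZ; exact: ltW.
apply: aZ => //; apply/cycP.
rewrite (@cdiff_index _ _ _ _ _ _ _ _ (m - 1 + 1)); last by rewrite subrK.
by rewrite hom_cyc_eq // scaler0.
Qed.

(** As r kills M, multiplication by r is null-homotopic on P. *)
Lemma hom_null (r : R) : (forall y : M, r *: y = 0) ->
  forall V m (f : homc P V m), cyc f -> bnd (r *: f).
Proof.
move=> r0.
pose A (p : nat) := {linear P p -> P p.+1}.
pose I p (s : A p) := forall y, pr_diff P p (s (pr_diff P p y)) = r *: pr_diff P p y.
pose Q p (s : A p) (s' : A p.+1) := forall y,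
  pr_diff P p.+1 (s' y) = r *: y - s (pr_diff P p y).
have [s0 s0P] : exists s0 : A 0%N, forall x, pr_diff P 0 (s0 x) = r *: x.
  have rl : linear (fun x : P 0%N => r *: x).
    by move=> c x y; rewrite scalerDr scalerC.
  apply: (@projective_lift _ (P 0%N) (P 1%N) (P 0%N) (linmap rl) (pr_diff P 0)
    (@pr_proj _ _ P 0%N)) => x.
  by apply/pr_exact0; rewrite /= linearZ_LR r0.
have [||s [sE sP]] := @dependent_recursion A I Q s0.
- by move=> y; rewrite s0P.
- move=> p s Is.
  have gl : linear (fun y : P p.+1 => r *: y - s (pr_diff P p y)).
    move=> c x y; rewrite [pr_diff P p _]linearP [s _]linearP.
    by rewrite scalerDr opprD addrACA scalerBr scalerC.
  have [|s' s'P] := @projective_lift _ (P p.+1) (P p.+2) (P p.+1) (linmap gl)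
      (pr_diff P p.+1) (@pr_proj _ _ P p.+1).
    by move=> y; apply/pr_exact; rewrite /= linearB linearZ_LR Is subrr.
  by exists s'; split=> // y; rewrite s'P /= pr_diff_comp linear0 subr0.
move=> V m f cf; pose e : R := (-1) ^+ absz m.
have ee : e * e = 1 by rewrite /e -expr2 sqrr_sign.
(* The null-homotopy of r f is f composed with s, up to the sign e. *)
have hl (p : nat) (q : int) : linear (fun y => e *: f p.+1 q (s p y)).
  by move=> c x y; rewrite linearP hom_lin scalerDr scalerC.
have hs (p : nat) (q : int) : q <> p%:Z + (m + 1) -> forall y, e *: f p.+1 q (s p y) = 0.
  by move=> n y; rewrite hom_shape ?scaler0 //; lia.
apply/bndP; exists (HomObj hl hs : homc P V (m + 1)); apply: hom_objP => p q y.
rewrite hom_diffE // exprN1S -/e scaleNr opprK /= linearZ_LR.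
rewrite hom_cyc_eq // -/e scalerA ee scale1r /=.
transitivity (r *: f p q y); last by [].
case: p y => [|p] y /=.
  rewrite sE s0P scaler0 addr0.
  by have := hom_lin f q r y 0; rewrite !hom_fun0 !addr0.
rewrite scalerA ee scale1r (sP p).2.
have := hom_lin f q 1 (r *: y - s p (pr_diff P p y)) (s p (pr_diff P p y)).
rewrite !scale1r subrK => <-.
by have := hom_lin f q r y 0; rewrite !hom_fun0 !addr0.
Qed.
End HomVanishing.

Section HomCone.
Context {R : comNzRingType}.
Variables (M : lmodType R) (P : projective_resolution M).

Section Iso.
Variables (U V : complex R) (f : cmap U V).

Fact hom_cone_lin0 m (z : cone (hom_map P f) m) p q :
  linear (fun x =>
    ((z.1 : homc P V m) p q x, (z.2 : homc P U (m - 1)) p (q - 1) x) : cone f q).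
Proof. by move=> c x y; rewrite !hom_lin. Qed.
Fact hom_cone_shape m (z : cone (hom_map P f) m) p q : q <> p%:Z + m -> forall x,
  ((z.1 : homc P V m) p q x, (z.2 : homc P U (m - 1)) p (q - 1) x) = 0 :> cone f q.
Proof. by move=> n x; rewrite !hom_shape //; lia. Qed.
Definition hom_cone_fun m (z : cone (hom_map P f) m) : homc P (cone f) m :=
  HomObj (hom_cone_lin0 z) (@hom_cone_shape m z).
Fact hom_cone_lin m : linear (@hom_cone_fun m).
Proof. by move=> c z w; apply: hom_objP => p q x. Qed.

Fact hom_cone_d i j z : cdiff (homc P (cone f)) i j (linmap (@hom_cone_lin i) z) =
  linmap (@hom_cone_lin j) (cdiff (cone (hom_map P f)) i j z).
Proof.
have [E|/eqP n] := eqVneq i (j + 1); last by rewrite !cdiff_shape ?linear0.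
case: z => g1 g2; apply: hom_objP => p q x; rewrite [LHS]hom_diffE //.
have -> : hom_precomp (pr_diff P) (linmap (@hom_cone_lin i) (g1, g2)) q x =
   (hom_precomp (pr_diff P) g1 q x, hom_precomp (pr_diff P) g2 (q - 1) x) :> cone f q.
  by case: p x.
transitivity (((cdiff (homc P V) i j g1 + tr (homc P V) (i - 1) j (hom_map P f (i - 1) g2)
   : homc P V j) p q x,
   (- cdiff (homc P U) (i - 1) (j - 1) g2 : homc P U (j - 1)) p (q - 1) x)
   : cone f q); last by [].
congr pair.
  transitivity ((cdiff (homc P V) i j g1 : homc P V j) p q x +
    (tr (homc P V) (i - 1) j (hom_map P f (i - 1) g2) : homc P V j) p q x); last by [].
  rewrite hom_diffE // hom_trE; last by lia.
  rewrite /= addrAC; congr (_ + _ + _); rewrite -tr_cmap; congr (f _ _).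
  by rewrite hom_index; last by lia.
transitivity
  (-1 *: ((cdiff (homc P U) (i - 1) (j - 1) g2 : homc P U (j - 1)) p (q - 1) x));
  last by [].
rewrite hom_diffE; last by lia.
transitivity (- cdiff U (q + 1 - 1) (q - 1) (g2 p (q + 1 - 1) x)
  - (-1) ^+ absz i *: hom_precomp (pr_diff P) g2 (q - 1) x); first by [].
have -> : (-1) ^+ absz i = - (-1) ^+ absz (i - 1) :> R by rewrite -exprN1S subrK.
rewrite scaleNr opprK scaleN1r opprB [LHS]addrC; congr (_ - _).
by apply: cdiff_index; lia.
Qed.

Definition hom_cone : cmap (cone (hom_map P f)) (homc P (cone f)) :=
  @CMap _ (cone (hom_map P f)) (homc P (cone f))
    (fun m => linmap (@hom_cone_lin m)) hom_cone_d.

Lemma hom_cone_qiso : qiso hom_cone.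
Proof.
apply: bij_qiso => m.
  move=> z w zw; have E p q x := congr1 (fun h : homc P (cone f) m => h p q x) zw.
  have E1 : z.1 = w.1.
    apply: hom_objP => p q x; exact: (congr1 (@fst (V q) (U (q - 1))) (E p q x)).
  have E2 : z.2 = w.2.
    apply: hom_objP => p q x.
    have := congr1 (tr U _ q)
      (congr1 (@snd (V (q + 1)) (U (q + 1 - 1))) (E p (q + 1) x)).
    rewrite /=.
    by rewrite !hom_index ?addrK.
  by case: z w E1 E2 {zw E} => z1 z2 [w1 w2] /= -> ->.
move=> h.
have l1 p q : linear (fun x => (h p q x).1) by move=> c x y; rewrite hom_lin.
have s1 p q : q <> p%:Z + m -> forall x, (h p q x).1 = 0.
  by move=> n x; rewrite hom_shape.
have l2 p q : linear (fun x => tr U (q + 1 - 1) q (h p (q + 1) x).2).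
  by move=> c x y; rewrite hom_lin -linearP.
have s2 p q : q <> p%:Z + (m - 1) -> forall x, tr U (q + 1 - 1) q (h p (q + 1) x).2 = 0.
  by move=> n x; rewrite hom_shape ?linear0 //; lia.
exists (HomObj l1 s1 : homc P V m, HomObj l2 s2 : homc P U (m - 1)).
have trh p q q' x : q' = q -> tr U (q' - 1) (q - 1) (h p q' x).2 = (h p q x).2.
  by move=> ->; rewrite trE.
apply: hom_objP => p q x; rewrite [RHS]surjective_pairing.
by congr pair; apply: trh; rewrite subrK.
Qed.

Lemma hom_cone_acyP m : acy (homc P (cone f)) m <->
  hsurj (hom_map P f) m /\ hinj (hom_map P f) (m - 1).
Proof. by rewrite -(qiso_acy m hom_cone_qiso) cone_acyP. Qed.

Lemma hom_cone_acy m : acy (homc P V) m -> acy (homc P U) (m - 1) ->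
  acy (homc P (cone f)) m.
Proof. by move=> aV aU; apply/(qiso_acy m hom_cone_qiso)/cone_acy. Qed.

(** The cone of f is acyclic, hence so is its Hom from P. *)
Lemma hom_qiso : qiso f -> qiso (hom_map P f).
Proof.
move=> fq; have ac m : acy (homc P (cone f)) m.
  apply: hom_acy => q _; apply/cone_acyP.
  by have [fs _] := fq q; have [_ fi] := fq (q - 1).
move=> m; have [fs _] := (hom_cone_acyP m).1 (ac m).
by have := (hom_cone_acyP (m + 1)).1 (ac _); rewrite addrK => -[_ fi].
Qed.
End Iso.

(** On the homology of Hom(P, X^(N)) multiplication by x vanishes, so the
    telescope map becomes the shift, which is onto with kernel the homology of
    Hom(P, X) at position 0. *)
Lemma hom_telc_acyP (x : R) (X : complex R) m : (forall y : M, x *: y = 0) ->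
  acy (homc P (telc X x)) m <-> acy (homc P X) (m - 1).
Proof.
move=> x0; rewrite hom_cone_acyP.
have telE' k (g : homc P (seqc X) k) :
    hom_map P (tel X x) k g = hom_map P (shift X) k g - x *: g.
  rewrite -scaleN1r; apply: hom_objP => p q y.
  by transitivity (shift_fun (g p q y) + -1 *: (x *: g p q y)); rewrite // scaleN1r.
have tel_shift k (g : homc P (seqc X) k) : cyc g ->
    bnd (hom_map P (shift X) k g - hom_map P (tel X x) k g).
  by move=> cg; rewrite telE' opprB addrC subrK; exact: hom_null.
split=> [[_ ti] f cf|aX].
  pose g := hom_map P (single X 0) _ f.
  have cg : cyc g by exact: cyc_map.
  have /(bnd_map (hom_map P (at0 X))) : bnd g.
    apply: ti => //; apply: bndBr (tel_shift _ _ cg) _.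
    rewrite (_ : hom_map P (shift X) _ g = 0); first exact: bnd0.
    by apply: hom_objP => p q y; apply: fseqP.
  by rewrite (_ : hom_map P (at0 X) _ g = f) //; exact: hom_objP.
split=> [g cg|g cg bg].
  exists (hom_map P (unshift X) _ g); first exact: cyc_map.
  have := tel_shift _ _ (cyc_map (hom_map P (unshift X)) cg).
  rewrite (_ : hom_map P (shift X) _ _ = g) //.
  by apply: hom_objP => p q y; apply: fseqP.
have bs : bnd (hom_map P (shift X) _ g) := bndBl (tel_shift _ _ cg) bg.
rewrite (_ : g = hom_map P (single X 0) _ (hom_map P (at0 X) _ g) +
  hom_map P (unshift X) _ (hom_map P (shift X) _ g)).
  apply: bndD; last exact: bnd_map.
  by apply/bnd_map/aX/cyc_map.
apply: hom_objP => p q y; apply: fseqP => -[|i].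
  by rewrite [RHS]addr0.
by rewrite [RHS]add0r.
Qed.

Lemma hom_tele_acyP (xs : seq R) (X : complex R) m :
  (forall x, x \in xs -> forall y : M, x *: y = 0) ->
  acy (homc P (tele xs X)) m <-> acy (homc P X) (m - (size xs)%:Z).
Proof.
elim: xs X m => [|x xs IH] X m xs0 /=; first by rewrite subr0.
rewrite IH; last by move=> y yxs; apply: xs0; rewrite inE yxs orbT.
rewrite hom_telc_acyP; last by apply: xs0; rewrite mem_head.
by rewrite (_ : m - _ - 1 = m - (size xs).+1%:Z) //; lia.
Qed.
End HomCone.

(** * Annihilation of classes by RHom out of the ideal *)
Section Shift.
Context {R : comNzRingType}.
Variable U : complex R.
Fact sh_lin i j : linear (fun u : U (i - 1) => - cdiff U (i - 1) (j - 1) u).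
Proof. by move=> c x y; rewrite linearP opprD scalerN. Qed.
Fact sh_shape i j : i <> j + 1 -> forall x, linmap (@sh_lin i j) x = 0.
Proof. by move=> n x; rewrite /= cdiff_shape ?oppr0 //; lia. Qed.
Fact sh_comp i j k x : linmap (@sh_lin j k) (linmap (@sh_lin i j) x) = 0.
Proof. by rewrite /= linearN cdiff_comp !oppr0. Qed.
Definition sh : complex R := @Complex R (fun m => U (m - 1)) _ sh_shape sh_comp.

Lemma sh_acy m : acy U (m - 1) -> acy sh m.
Proof.
move=> aU x cx; have /aU/bndP[y Ey] : cyc (x : U (m - 1)).
  by apply/cycP/oppr_inj; rewrite oppr0; exact: (cx (m - 1)).
apply/bndP; exists (- tr U _ (m + 1 - 1) y); rewrite /= linearN opprK.
by rewrite (@tr_cdiff _ U _ (m - 1)) ?trE //; lia.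
Qed.
End Shift.

Lemma cone_sh_ses (R : comNzRingType) (U V : complex R) (f : cmap U V) :
  exists g : cmap (cone f) (sh U), ses (cone_inl f) g.
Proof.
have l m : linear (fun z : cone f m => z.2 : sh U m) by move=> c x y.
exists (@CMap _ (cone f) (sh U) (fun m => linmap (@l m)) (fun i j x => erefl)).
split=> m.
- by move=> v w /(congr1 fst).
- by move=> u; exists (0, u).
- move=> [v u]; split=> /= [->|[w [_ <-]] //]; by exists v.
Qed.

Section Evaluation.
Context {R : comNzRingType}.
Variables (a : submodClosed R^o) (P : projective_resolution (quotmod a)).
Variable p0 : P 0%N.
Hypothesis p0E : pr_aug P p0 = qpi a 1.
Implicit Types U V W X Y Z : complex R.

Lemma quotmod_killed r (y : quotmod a : lmodType R) : r \in a -> r *: y = 0.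
Proof.
move=> ra; have [x <-] := qpi_surj y.
apply: (etrans (esym (@qpiZ R _ a r x))); rewrite -(linear0 (qpi a)).
by apply/qpi_eq; rewrite subr0 /GRing.scale /= mulrC; exact: (@rpredZ R R^o a x).
Qed.

Fact ev_lin V m : linear (fun f : homc P V m => f 0%N m p0 : V m).
Proof. by []. Qed.
Fact ev_d V i j (f : homc P V i) :
  cdiff V i j (f 0%N i p0) = (cdiff (homc P V) i j f : homc P V j) 0%N j p0.
Proof.
have [E|/eqP n] := eqVneq i (j + 1); last by rewrite !cdiff_shape.
by subst i; rewrite hom_diffE //= scaler0 subr0.
Qed.
Definition ev V : cmap (homc P V) V :=
  @CMap _ (homc P V) V (fun m => linmap (@ev_lin V m)) (@ev_d V).

(** P_0 is generated by p0 and boundaries, so a cycle is known on P_0 modulo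
    boundaries once it is known at p0. *)
Lemma hom_bnd_ev Z m (f : homc P Z m) : (forall q, m < q -> acy Z q) ->
  cyc f -> bnd (ev Z m f) -> bnd f.
Proof.
move=> aZ cf b0; apply: hom_bnd => // x.
have [r Er] := qpi_surj (pr_aug P x).
have /pr_exact0[y Ey] : pr_aug P (x - r *: p0) = 0.
  rewrite linearB linearZ_LR p0E -linearZ_LR -Er -linearB.
  by rewrite /GRing.scale /= mulr1 subrr linear0.
rewrite -[x](subrK (r *: p0)) -Ey.
have -> : f 0%N m (pr_diff P 0 y + r *: p0) = r *: f 0%N m p0 + f 0%N m (pr_diff P 0 y).
  by rewrite addrC hom_lin.
apply: bndD; first exact: bndZ.
have e2 : (-1) ^+ absz m * (-1) ^+ absz m = 1 :> R by rewrite -expr2 sqrr_sign.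
have := @hom_cyc_eq _ _ P Z m f 1%N m y cf; rewrite /=.
move=> /(congr1 (fun u => (-1) ^+ absz m *: u)); rewrite scalerA e2 scale1r => <-.
exact/bndZ/bnd_d.
Qed.

(** A model of RHom(a, V), as R -> R/a has fibre a; the inclusion of V is
    restriction along the inclusion of a in R. *)
Definition lcone V : complex R := cone (ev V).
Fact ev_nat V W (f : cmap V W) m u : ev W m (hom_map P f m u) = f m (ev V m u).
Proof. by []. Qed.
Definition lmap V W (f : cmap V W) : cmap (lcone V) (lcone W) := cone_map (ev_nat f).

Lemma lcone_acy_gt V e : (forall m, e < m -> acy V m) ->
  forall m, e < m -> acy (lcone V) m.
Proof.
move=> aV m em; apply/cone_acyP; split=> [v cv|f cf bf].
  by exists 0; [exact: cyc0 | rewrite [ev V m 0]linear0 subr0; exact: aV].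
by apply: hom_bnd_ev bf => // q mq; apply: aV; lia.
Qed.

Lemma lmap_sq V W W' Z
    (f : cmap V W) (g : cmap W Z) (f' : cmap V W') (g' : cmap W' Z) :
  (forall m x, g m (f m x) = g' m (f' m x)) ->
  forall m x, lmap g m (lmap f m x) = lmap g' m (lmap f' m x).
Proof.
move=> sq m [v u]; congr pair; first exact: sq.
by apply: hom_objP => p q x; exact: sq.
Qed.

Fixpoint lpow k V : complex R := if k is k'.+1 then lpow k' (lcone V) else V.
Fixpoint lpmap k V W (f : cmap V W) : cmap (lpow k V) (lpow k W) :=
  if k is k'.+1 return cmap (lpow k V) (lpow k W) then lpmap k' (lmap f) else f.

Lemma lpmap_sq k V W W' Z
    (f : cmap V W) (g : cmap W Z) (f' : cmap V W') (g' : cmap W' Z) :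
  (forall m x, g m (f m x) = g' m (f' m x)) ->
  forall m x, lpmap k g m (lpmap k f m x) = lpmap k g' m (lpmap k f' m x).
Proof. by elim: k V W W' Z f g f' g' => //= k IH *; apply/IH/lmap_sq. Qed.

Lemma lpmap_id k V (f : cmap V V) : (forall m x, f m x = x) ->
  forall m x, lpmap k f m x = x.
Proof.
elim: k V f => //= k IH V f fE; apply: IH => m [v u]; congr pair; first exact: fE.
by apply: hom_objP => p q x; exact: fE.
Qed.

Lemma lpow_ses k X Y Z (f : cmap X Y) (g : cmap Y Z) :
  ses f g -> ses (lpmap k f) (lpmap k g).
Proof.
elim: k X Y Z f g => //= k IH X Y Z f g fg; apply: IH.
by apply: cone_ses => //; exact: hom_ses.
Qed.

Lemma lpmap_qiso k X Y (f : cmap X Y) : qiso f -> qiso (lpmap k f).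
Proof.
elim: k X Y f => //= k IH X Y f fq; apply: IH.
by apply: cone_map_qiso => //; exact: hom_qiso.
Qed.

Lemma lpow_acy_gt k V e : (forall m, e < m -> acy V m) ->
  forall m, e < m -> acy (lpow k V) m.
Proof. by elim: k V => //= k IH V aV; apply: IH; exact: lcone_acy_gt. Qed.

(** The k-th power of the functor applied to V -> lcone V, rather than the map
    V -> lcone V for lpow k V: the cone of the former is a power of the functor
    applied to Hom(P, V), so its homology is controlled by that of Hom(P, V). *)
Definition leta k V : cmap (lpow k V) (lpow k.+1 V) := lpmap k (cone_inl (ev V)).

Lemma leta_nat k V W (f : cmap V W) m x :
  leta k W m (lpmap k f m x) = lpmap k.+1 f m (leta k V m x).
Proof.
apply: (@lpmap_sq k V W (lcone V) (lcone W) f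
  (cone_inl (ev W)) (cone_inl (ev V)) (lmap f)).
by move=> n v; congr pair; rewrite linear0.
Qed.

(** A complex of R/a-modules is a retract of its Hom from P, evaluation being
    split by the action of R/a; so its map to the cone of evaluation factors
    through the cone of the identity. *)
Lemma leta_killed k V : (forall m (v : V m) r, r \in a -> r *: v = 0) ->
  forall m x, cyc x -> bnd (leta k V m x).
Proof.
move=> Va m x cx.
(* g turns the augmentation into an action of P_0 on V by scalars of R. *)
have [g gP] : exists g : {linear P 0%N -> R^o}, forall y, qpi a (g y) = pr_aug P y.
  by apply: projective_lift (@pr_proj _ _ P 0%N) _ => y; exact: qpi_surj.
have gd y : g (pr_diff P 0 y) \in a.
  rewrite -[X in X \in _]subr0; apply/qpi_eq; rewrite gP linear0.
  by apply/pr_exact0; exists y.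
pose h n (v : V n) (p : nat) q : P p -> V q :=
  if p is 0 then fun y => tr V n q (g y *: v) else fun=> 0.
have hl n v p q : linear (h n v p q).
  case: p => [|p] c y z; last by rewrite /= scaler0 addr0.
  by rewrite /h [g _]linearP scalerDl linearD -[(c *: g y) *: v]scalerA linearZ_LR.
have hs n v p q : q <> p%:Z + n -> forall y, h n v p q y = 0.
  by case: p => //= ne y; rewrite tr_neq //; lia.
pose s n (v : V n) : homc P V n := HomObj (hl n v) (hs n v).
have sl n : linear (@s n).
  move=> c v w; apply: hom_objP => -[|p] q y /=; last by rewrite scaler0 addr0.
  by rewrite scalerDr scalerC linearP.
have sd i j v : cdiff (homc P V) i j (linmap (sl i) v) = linmap (sl j) (cdiff V i j v).
  have [E|/eqP n] := eqVneq i (j + 1); last by rewrite !cdiff_shape ?linear0.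
  apply: hom_objP => p q y; rewrite hom_diffE //; case: p y => [|[|p]] y /=.
  - rewrite scaler0 subr0; have [Ej|/eqP n] := eqVneq j q.
      by subst q; rewrite (@tr_cdiff _ V _ j) ?trE ?linearZ_LR //; lia.
    by rewrite [RHS]tr_neq // tr_neq ?linear0 //; lia.
  - by rewrite [cdiff V _ q 0]linear0 (Va _ _ _ (gd y)) [tr V i q 0]linear0 scaler0 subrr.
  - by rewrite [cdiff V _ q 0]linear0 scaler0 subrr.
pose sec : cmap V (homc P V) := @CMap _ V (homc P V) (fun n => linmap (sl n)) sd.
(* g p0 acts as the identity because it is 1 modulo a. *)
have secE n v : ev V n (sec n v) = cmap_id V n (cmap_id V n v).
  rewrite /= trE; apply/eqP; rewrite -subr_eq0 -{2}[v]scale1r -scalerBl; apply/eqP.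
  by apply: Va; apply/qpi_eq; rewrite gP p0E.
pose psi : cmap (cone (cmap_id V)) (lcone V) := cone_map secE.
have aid n : acy (lpow k (cone (cmap_id V))) n.
  apply: (@lpow_acy_gt k _ (n - 1)); last by lia.
  move=> q _; apply/cone_acyP; split=> // v cv.
  by exists v; rewrite // subrr; exact: bnd0.
rewrite -(@lpmap_id k V (cmap_id V) (fun _ _ => erefl) m x).
rewrite -(@lpmap_sq k _ _ _ _ (cone_inl (cmap_id V)) psi).
  by apply/bnd_map/aid/cyc_map.
by move=> n v; congr pair; rewrite linear0.
Qed.

(** A recursive predicate, since the target of the composite of N maps
    lpow k V -> lpow k.+1 V -> .. would have a type depending on k + N. *)
Fixpoint dies N k V m (v : lpow k V m) : Prop :=
  if N is N'.+1 then @dies N' k.+1 V m (leta k V m v) else bnd v.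

Lemma dies_bnd N k V m (v : lpow k V m) : bnd v -> dies N v.
Proof. by elim: N k v => //= N IH k v bv; apply/IH/bnd_map. Qed.

Lemma diesD N k V m (v w : lpow k V m) : dies N v -> dies N w -> dies N (v + w).
Proof.
elim: N k v w => [|N IH] k v w /=; first exact: bndD.
by rewrite linearD; exact: IH.
Qed.

Lemma dies_map N k V W (f : cmap V W) m (v : lpow k V m) :
  dies N v -> dies N (lpmap k f m v).
Proof.
elim: N k v => [|N IH] k v /=; first exact: bnd_map.
by move=> /IH; rewrite leta_nat.
Qed.

Definition dying N V := forall k m (v : lpow k V m), cyc v -> dies N v.

(** One step sends a class of Y to zero in Z, hence moves it into X. *)
Lemma dying_ses N X Y Z (f : cmap X Y) (g : cmap Y Z) : ses f g ->
  dying N X -> (forall m (v : Z m) r, r \in a -> r *: v = 0) -> dying N.+1 Y.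
Proof.
move=> fg dX Za k m v cv /=.
have [|u cu bu] := ses_lift (lpow_ses k.+1 fg) (cyc_map (leta k Y) cv).
  by rewrite -leta_nat; apply: leta_killed => //; exact: cyc_map.
rewrite -[leta k Y m v](subrK (lpmap k.+1 f m u)); apply: diesD; first exact: dies_bnd.
exact/dies_map/dX.
Qed.

Lemma dying_qiso N X Y (f : cmap X Y) : qiso f -> dying N X -> dying N Y.
Proof.
move=> fq dX k m v cv; have [fs _] := lpmap_qiso k fq m.
have [u cu bu] := fs v cv; rewrite -[v](subrK (lpmap k f m u)).
by apply: diesD; [exact: dies_bnd | exact/dies_map/dX].
Qed.

(** Up to quasi-isomorphism, a bounded complex whose homology is killed by a is
    built from R/a-modules in finitely many steps, the truncations. *)
Lemma bounded_dying V s t :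
  (forall m, m < s -> acy V m) -> (forall m, t <= m -> acy V m) ->
  (forall m (v : V m) r, r \in a -> cyc v -> bnd (r *: v)) -> exists N, dying N V.
Proof.
move=> Vs Vt Va.
have key k l : t <= l + k%:Z -> dying k (trunc_ge V l).
  elim: k l => [|k IH] l tl.
    move=> k m v; apply: (@lpow_acy_gt k _ (m - 1)); last by lia.
    by move=> q _; apply: trunc_ge_acy => lq; apply: Vt; lia.
  apply: (dying_ses (trunc_ses V l)).
    by apply: (dying_qiso (@trunc_ge_gt_qiso _ V l)); apply: IH; lia.
  move=> m v r ra; apply: val_inj; apply: etrans (esym (submod_val0 _)).
  change (r *: (val v) = 0); have [x cx <-] := hcls_surj (val v).
  have := @hclsP _ V l r x 0 cx (@cyc0 _ V l); rewrite addr0.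
  rewrite (hcls_eq0 (@cyc0 _ V l)).2 ?addr0 => [<-|]; last exact: bnd0.
  by apply/hcls_eq0; [exact: cycZ | exact: Va].
exists (absz (t - s)); apply: (dying_qiso (trunc_ge_qiso Vs)).
by apply: key; lia.
Qed.

(** The cokernel of each map is a power of the functor applied to Hom(P, W), up
    to a shift, and has no homology in the degrees that matter. *)
Lemma dies_inj W e : (forall m, e < m -> acy (homc P W) m) ->
  forall N k m (v : lpow k W m), e < m -> cyc v -> dies N v -> bnd v.
Proof.
move=> aW; elim=> [|N IH] k m v em cv //= dv.
have := IH _ _ _ em (cyc_map _ cv) dv; have [g sg] := cone_sh_ses (ev W).
apply: (ses_hinj (lpow_ses k sg)) cv.
apply: (@lpow_acy_gt k _ (e + 1)); last by lia.
by move=> q eq; apply/sh_acy/aW; lia.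
Qed.
End Evaluation.

(** * Koszul complexes *)
Section Koszul.
Context {R : comNzRingType}.
Implicit Types (U V W X : complex R) (x : R) (xs : seq R).

(** The homotopy h is indexed by its source and target degrees; only its
    components of degree 1 count. *)
Definition nullhtpy x V : Prop := exists h : forall i j, {linear V i -> V j},
  forall i j k (v : V i), j = i + 1 -> i = k + 1 ->
    x *: v = cdiff V j i (h i j v) + h k i (cdiff V i k v).

Lemma nullhtpy_bnd x V m (v : V m) : nullhtpy x V -> cyc v -> bnd (x *: v).
Proof.
move=> [h hP] cv; rewrite (hP m (m + 1) (m - 1)) ?subrK // cv linear0 addr0.
exact: bnd_d.
Qed.

Definition kosz x V : complex R := cone (scal x V).
Fixpoint koszul xs V : complex R := if xs is x :: xs' then koszul xs' (kosz x V) else V.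

Lemma kosz_nullhtpy x V : nullhtpy x (kosz x V).
Proof.
have hl i j : linear (fun z : kosz x V i => (0, tr V i (j - 1) z.1) : kosz x V j).
  by move=> c z w; congr pair; rewrite /= ?linearP // scaler0 addr0.
exists (fun i j => linmap (hl i j)) => i j k [v u] Ej Ek.
rewrite /= /cone_fun /=; congr pair.
  rewrite /= linear0 add0r addr0 [tr V _ i (x *: _)]linearZ_LR /= trK //; lia.
rewrite /= (@tr_cdiff _ V _ k); last by lia.
rewrite [tr V k _ (_ + _)]linearD addKr /= trK //; lia.
Qed.

Lemma kosz_nullhtpy_map x y V : nullhtpy x V -> nullhtpy x (kosz y V).
Proof.
move=> [h hP].
have hl i j : linear (fun z : kosz y V i =>
    (h i j z.1, - h (i - 1) (j - 1) z.2) : kosz y V j).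
  move=> c z w; congr pair; rewrite /= linearP //.
  by rewrite opprD scalerN.
have htr i i' j j' (v : V i) : i = i' -> j = j' ->
    tr V j j' (h i j v) = h i' j' (tr V i i' v).
  by move=> ? ?; subst i' j'; rewrite !trE.
exists (fun i j => linmap (hl i j)) => i j k [v u] Ej Ek.
have E : tr V (j - 1) i (y *: - h (i - 1) (j - 1) u) = - h k i (tr V (i - 1) k (y *: u)).
  rewrite scalerN -[y *: h _ _ u]linearZ_LR linearN; congr (- _).
  by apply: htr; lia.
rewrite /= /cone_fun /=; congr pair; rewrite /=.
  by rewrite E [h k i (_ + _)]linearD addrACA addNr addr0; exact: hP.
rewrite !linearN !opprK; apply: hP; lia.
Qed.

Lemma koszul_nullhtpy_map xs x V : nullhtpy x V -> nullhtpy x (koszul xs V).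
Proof. by elim: xs V => //= y xs IH V nV; apply/IH/kosz_nullhtpy_map. Qed.

Lemma koszul_nullhtpy xs x V : x \in xs -> nullhtpy x (koszul xs V).
Proof.
elim: xs V => //= y xs IH V; rewrite inE => /orP[/eqP ->|/IH //].
exact/koszul_nullhtpy_map/kosz_nullhtpy.
Qed.

Lemma koszul_acy_lt xs V s : (forall m, m < s -> acy V m) ->
  forall m, m < s -> acy (koszul xs V) m.
Proof.
elim: xs V => //= x xs IH V aV; apply: IH => m ms.
by apply: cone_acy; apply: aV; lia.
Qed.

Lemma koszul_acy_ge xs V t : (forall m, t <= m -> acy V m) ->
  forall m, t + (size xs)%:Z <= m -> acy (koszul xs V) m.
Proof.
elim: xs V t => [|x xs IH] V t aV m tm /=; first by apply: aV; rewrite addr0 in tm.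
apply: (IH _ (t + 1)) => [k tk|]; last by move: tm => /=; lia.
by apply: cone_acy; apply: aV; lia.
Qed.

(** If multiplication by x is injective and torsion on a homology module, then
    that module is zero; the Koszul homology in the next degree has the
    kernel of x as a quotient. *)
Lemma koszul_acy_htors xs V m : (forall x, x \in xs -> htors x V) ->
  acy (koszul xs V) (m + (size xs)%:Z) -> acy V m.
Proof.
elim: xs V m => [|x xs IH] V m tV /=; first by rewrite addr0.
rewrite (_ : m + (size xs).+1%:Z = m + 1 + (size xs)%:Z); last by lia.
have tx := tV x (mem_head _ _).
move=> /IH aK; have /cone_acyP[_] : acy (kosz x V) (m + 1).
  apply: aK => y yxs; have ty : htors y V by apply: tV; rewrite inE yxs orbT.
  exact: cone_htors.
rewrite addrK => xi u cu; have [k] := tx m u cu.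
elim: k => [|k IHk]; first by rewrite scale1r.
rewrite exprS -scalerA => b; apply: IHk; apply: xi b; exact: cycZ.
Qed.

(** Maps out of U into a complex on which x is null-homotopic extend to the
    cone of x on U.  Starting from R, this extends the map out of R given by a
    cycle to the Koszul complex of R, whose homology is killed by the ideal. *)
Lemma kosz_extend x U W (f : cmap U W) : nullhtpy x W ->
  exists g : cmap (kosz x U) W, forall m u, g m (u, 0) = f m u.
Proof.
move=> [h hP].
have gl m : linear (fun z : kosz x U m => f m z.1 + h (m - 1) m (f (m - 1) z.2)).
  by move=> c z w; rewrite /= !linearP /= scalerDr addrACA.
have gd i j z : cdiff W i j (linmap (gl i) z) = linmap (gl j) (cdiff (kosz x U) i j z).
  have [E|/eqP n] := eqVneq i (j + 1); last by rewrite !cdiff_shape // linear0.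
  case: z => v u; rewrite /= /cone_fun /=.
  rewrite [cdiff W i j (_ + _)]linearD cmapd [f j (_ + _)]linearD -addrA; congr (_ + _).
  have trd w : tr W (i - 1) j (cdiff W i (i - 1) w) = cdiff W i j w.
    by rewrite -(@tr_cdiff _ W i _ i) ?trE //; lia.
  have trh w : tr W (i - 1) j (h (j - 1) (i - 1) w) = h (j - 1) j w.
    by have -> : i - 1 = j; [lia | rewrite trE].
  rewrite [f _ (- _)]linearN [h _ _ (- _)]linearN -cmapd tr_cmap [f _ (x *: u)]linearZ_LR.
  rewrite (hP (i - 1) i (j - 1)); [|lia|lia].
  by rewrite [tr W _ j (_ + _)]linearD /= trd trh addrK.
exists (@CMap _ (kosz x U) W (fun m => linmap (gl m)) gd) => m u.
by rewrite /= !linear0 addr0.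
Qed.

Lemma koszul_extend xs U W (f : cmap U W) m (u : U m) :
  (forall x, x \in xs -> nullhtpy x W) -> cyc u ->
  exists (g : cmap (koszul xs U) W) v, cyc v /\ g m v = f m u.
Proof.
elim: xs U f u => [|x xs IH] U f u nW cu; first by exists f, u.
have [g gE] := kosz_extend f (nW x (mem_head _ _)).
have [|| g' [v [cv E]]] := IH _ g ((u, 0) : kosz x U m).
- by move=> y yxs; apply: nW; rewrite inE yxs orbT.
- exact/cone_inl_cyc.
by exists g', v; rewrite E gE.
Qed.

Lemma cyc_map_conc W m (w : W m) : cyc w ->
  exists (f : cmap (conc (R^o : lmodType R) m) W) u, f m u = w.
Proof.
move=> cw.
have l q : linear (fun r : conc (R^o : lmodType R) m q => tr W m q (val r *: w)).
  move=> c r s; rewrite -linearP; congr (tr _ _ _ _).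
  by rewrite scalerA -scalerDl.
have d i j r : cdiff W i j (linmap (l i) r) = linmap (l j) 0.
  rewrite linear0 /=; have [E|/eqP n] := eqVneq m i; last by rewrite tr_neq ?linear0.
  by subst i; rewrite trE linearZ_LR cw scaler0.
have H : m <> m -> (1 : R^o) = 0 by [].
exists (@CMap _ (conc (R^o : lmodType R) m) W (fun q => linmap (l q)) d), (conc_in H).
by rewrite /= trE scale1r.
Qed.
End Koszul.

(** * Depth and cohomological dimension *)
Section Main.
Context {R : comNzRingType}.
Variables (a : submodClosed R^o) (xs : seq R).
Hypothesis axs : a =i ideal_gen [set` xs].
Variable P : projective_resolution (quotmod a).

Lemma koszul_killed (V : complex R) m (v : koszul xs V m) r :
  r \in a -> cyc v -> bnd (r *: v).
Proof.
move=> ra cv.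
have S : submod_axioms (fun r : R^o => bnd (r *: v)).
  split; first by rewrite scale0r; exact: bnd0.
  - by move=> r1 r2 b1 b2; rewrite scalerDl; exact: bndD.
  - by move=> c r1 b1; rewrite -scalerA; exact: bndZ.
apply/(in_submod_of S); apply: (gen_sub axs) ra => x xxs; apply/(in_submod_of S).
exact: nullhtpy_bnd (koszul_nullhtpy _ xxs) cv.
Qed.

(** A class w is the image of a class of the Koszul complex K of R, which is
    annihilated after finitely many steps V -> RHom(a, V).  The same steps are
    injective on the homology of W in degrees > e. *)
Lemma nullhtpy_acy_gt (W : complex R) e : (forall x, x \in xs -> nullhtpy x W) ->
  (forall m, e < m -> acy (homc P W) m) -> forall m, e < m -> acy W m.
Proof.
move=> nW aW m em w cw; have [p0 p0E] := pr_aug_surj P (qpi a 1).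
have [f [u <-]] := cyc_map_conc cw.
have [g [v [cv <-]]] := koszul_extend f (u := u) nW (@conc_cyc _ _ _ _ _).
pose K := koszul xs (conc (R^o : lmodType R) m).
have [N dN] : exists N, dying p0 N K.
  apply: (@bounded_dying _ _ _ _ p0E _ m (m + 1 + (size xs)%:Z)).
  - by apply: koszul_acy_lt => k km; apply: conc_acy; lia.
  - by apply: koszul_acy_ge => k km; apply: conc_acy; lia.
  - by move=> k z r; exact: koszul_killed.
apply: (@dies_inj _ _ _ _ p0E _ _ aW N 0%N) => //; first exact: cyc_map.
exact: (dies_map g (dN 0%N m v cv)).
Qed.

Lemma hom_koszul_acy_gt (V : complex R) e ys : (forall m, e < m -> acy (homc P V) m) ->
  forall m, e + (size ys)%:Z < m -> acy (homc P (koszul ys V)) m.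
Proof.
elim: ys V e => [|y ys IH] V e aV m em /=; first by apply: aV; rewrite addr0 in em.
apply: (IH _ (e + 1)) => [k ek|]; last by move: em => /=; lia.
by apply: hom_cone_acy; apply: aV; lia.
Qed.

(** Apply the previous criterion to the Koszul complex of Y: both the
    bound on RHom(R/a, Y) and the degree in which a class of the homology of Y
    shows up move by the number of generators. *)
Lemma htors_acy_gt (Y : complex R) e : (forall x, x \in xs -> htors x Y) ->
  (forall m, e < m -> acy (homc P Y) m) -> forall m, e < m -> acy Y m.
Proof.
move=> tY aY m em; apply: (@koszul_acy_htors _ xs) => //.
apply: (@nullhtpy_acy_gt _ (e + (size xs)%:Z)); last by lia.
  by move=> x xxs; exact: koszul_nullhtpy.
exact: hom_koszul_acy_gt.
Qed.

(** The derived torsion of X vanishes in degrees <= t by the hypothesis on local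
    cohomology, and in degrees > t by the hypothesis on RHom(R/a, X). *)
Lemma hom_acy_of_local_cohomology (Rnoeth : noetherian_ring R) (X : complex R) (t : int) :
  D_plus X -> (forall m, t < m -> acy (homc P X) m) ->
  (forall l (i : nat), - t <= i%:Z - l ->
     trivial_module (local_cohomology a i (homology X l))) ->
  forall m, acy (homc P X) m.
Proof.
move=> Xp aX Xlc.
have xs0 x : x \in xs -> forall y : quotmod a : lmodType R, x *: y = 0.
  by move=> xxs y; apply: quotmod_killed; exact: (gen_in axs).
have aY m : acy (tele xs X) m.
  have [mt|tm] := leP m (t + (size xs)%:Z); first exact: (tele_acy_le Rnoeth axs Xp Xlc).
  apply: htors_acy_gt tm => [x xxs|k tk]; first exact: tele_htors_in.
  by apply/hom_tele_acyP => //; apply: aX; lia.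
move=> m; have := @hom_acy _ _ P (tele xs X) (m + (size xs)%:Z) (fun q _ => aY q).
by move/(hom_tele_acyP P _ _ xs0); rewrite addrK.
Qed.
End Main.

Local Open Scope ereal_scope.
Theorem theorem3p3 (R : comNzRingType) (Rnoeth : noetherian_ring R)
    (Rlocal : local_ring R) (a : submodClosed R^o) (X : complex R)
    (X_D_plus : D_plus X) (depth_fin : (depth a X < +oo)%E) :
  (depth a X <= cd a X)%E.
Proof.
rewrite leNgt; apply/negP => lt_cd.
pose P := free_resolution (quotmod a : lmodType R).
have [xs axs] := Rnoeth a.
have [l nl] : exists l : int, ~ trivial_module (homology (homc P X) l).
  apply: contrapT => no; move: depth_fin; rewrite /depth /hsup.
  rewrite (_ : [set _ | l in _]%classic = classical_sets.set0); last first.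
    by rewrite -subset0 => y [l nl _]; apply: no; exists l.
  by rewrite /zsup supremum0.
have ub k : ~ trivial_module (homology (homc P X) k) -> k%:E <= hsup (homc P X).
  by move=> nk; apply: (zsupP _).1; exists k.
have [t Et] : exists t : int, hsup (homc P X) = t%:E.
  case E : (hsup (homc P X)) => [s||]; first by exists s.
    by move: lt_cd; rewrite /depth -/(homc P X) E ltNge leNye.
  by move: (ub l nl); rewrite E.
apply/nl/trivial_homology.
apply: (hom_acy_of_local_cohomology axs Rnoeth (t := t)) => // [m tm|k i ki].
  apply/trivial_homology; apply: contrapT => /ub.
  by rewrite Et lee_fin leNgt tm.
apply: contrapT => ni; move: lt_cd; rewrite /depth -/(homc P X) Et ltNge => /negP; apply.
apply: (@le_trans _ _ (cd_module a (homology X k) - k%:E)); last first.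
  by apply: (zsupP _).1; exists k.
apply: (@le_trans _ _ (i%:Z%:E - k%:E)); first by rewrite -EFinB -EFinN lee_fin.
by apply: leeB => //; apply: (zsupP _).1; exists i.
Qed.
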